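(* Let $Z$ and $Y$ be separable real Hilbert spaces with $1\leq m=\dim Y<\infty$, let $X\subset Z$ be a Borel set, and let $v\colon X\to Y$ be a map. Then property (E) for $v$ (see context) holds if and only if, for some fixed $p\geq 1$, the inequality $$\mathsf B^{[m]}_{p,Y}(v_\#\nu\mid v_\#\mu)\leq \mathsf B^{[m]}_{p,Z}(\nu\mid\mu)$$ holds for all finitely supported probability measures $\mu,\nu$ on $X$. Moreover, if (E) holds, then $$\mathsf B^{[q]}_{p,Y}(v_\#\nu\mid v_\#\mu)\leq \mathsf B^{[q]}_{p,Z}(\nu\mid\mu)$$ for every $p\geq 1$, all $\mu,\nu\in\mathcal P_p(X)$, and every integer $q$ with $1\leq q\leq m$.
   Context: Property (E) for $v\colon X\to Y$: for every $A\subset X$, every $\rho\geq 0$, and every $1$-Lipschitz map $u\colon A\to Y$ satisfying $\|u(x)-v(x)\|\leq\rho$ for all $x\in A$, there is a $1$-Lipschitz map $\widetilde u\colon X\to Y$ with $\widetilde u|_A=u$ and $\|\widetilde u(x)-v(x)\|\leq\rho$ for all $x\in X$. For a separable real Hilbert space $H$ and $p\geq 1$, $\mathcal P_p(H)$ is the set of Borel probability measures on $H$ with finite $p$th moment; for a Borel set $E\subset H$, $\mathcal P_p(E)$ denotes the members of $\mathcal P_p(H)$ concentrated on $E$. Finite branching cost: for an integer $q\geq 1$ and $\mu,\nu\in\mathcal P_p(H)$, let $\Gamma_q(\mu,\nu)$ be the class of all triples $(S,T,U)$ of random variables defined on a common probability space such that $S\sim\mu$, $T\sim\nu$, $U$ takes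 values in a standard Borel space, and a regular conditional kernel $\kappa(s,u;\cdot)$ for $T$ given $(S,U)$ is concentrated on at most $q$ points for $\mathcal L(S,U)$-almost every $(s,u)$, where $\mathcal L(S,U)$ is the joint law of $(S,U)$ (this condition does not depend on the chosen version of the kernel). No independence of $U$ from $(S,T)$ is required. Define $$\mathsf B^{[q]}_{p,H}(\nu\mid\mu)=\inf\left\{\mathbb E\big\|S-\mathbb E[T\mid S,U]\big\|^p \;\middle|\; (S,T,U)\in\Gamma_q(\mu,\nu)\right\},$$ with conditional expectations understood in the Bochner sense. Pushforwards: for a finitely supported probability measure $\mu=\sum_i a_i\delta_{x_i}$ on $X$, $v_\#\mu=\sum_i a_i\delta_{v(x_i)}$, which requires no measurability of $v$. Under (E) the map $v$ is $1$-Lipschitz, hence Borel, and $v_\#\mu$ is the usual pushforward for general $\mu\in\mathcal P_p(X)$. Measures on $X$ are regarded as measures on $Z$ concentrated on $X$. *)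

(* Defs.v *)
From HB Require Import structures.
From mathcomp Require Import all_boot all_order all_algebra.
From mathcomp Require Import all_classical all_reals all_analysis.
From mathcomp Require Import sesquilinear.

Set Implicit Arguments.
Unset Strict Implicit.
Unset Printing Implicit Defensive.

Import Order.TTheory GRing.Theory Num.Theory.
Import numFieldNormedType.Exports.

Local Open Scope classical_set_scope.
Local Open Scope ring_scope.

(** A (complete) normed module is a real Hilbert space when its norm is induced
    by an inner product. *)
Definition is_hilbert (R : realType) (V : completeNormedModType R) : Prop :=
  exists dot : {dot V for idfun}, forall x : V, `|x| ^+ 2 = dot x x.

Definition separable (T : topologicalType) : Prop :=
  exists2 D : set T, countable D & dense D.

Definition dim_eq (R : realType) (V : lmodType R) (m : nat) : Prop :=
  exists f : {linear V -> 'rV[R]_m}, bijective f.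

Notation borel V := (g_sigma_algebraType (@open V)).

(** Property (E).  A map on a subset of [Z] is represented by a total function
    of which only the values on that subset are used. *)
Definition property_E (R : realType) (Z Y : completeNormedModType R)
    (X : set Z) (v : Z -> Y) : Prop :=
  forall (A : set Z) (rho : R) (u : Z -> Y),
    A `<=` X -> 0 <= rho -> 1.-lipschitz_A u ->
    (forall x, A x -> `|u x - v x| <= rho) ->
    exists ut : Z -> Y, [/\ 1.-lipschitz_X ut,
      (forall x, A x -> ut x = u x) &
      (forall x, X x -> `|ut x - v x| <= rho)].

(** Isomorphic, as a measurable space, to a Polish space with its Borel sets. *)
Definition standard_borel (R : realType) d (E : measurableType d) : Prop :=
  exists (W : completePseudoMetricType R) (f : E -> borel W) (g : borel W -> E),
    [/\ hausdorff_space W, separable W,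
        measurable_fun setT f & measurable_fun setT g] /\
    (cancel f g /\ cancel g f).

Section Bochner.
Context (R : realType) (H : completeNormedModType R).
Context d (Omega : measurableType d) (P : probability Omega R).

Definition simple_integral (D : set Omega) (s : Omega -> borel H) : H :=
  \sum_(y \in range s) fine (P (D `&` s @^-1` [set y])) *: (y : H).

(** [f] is Bochner integrable on [D] with integral [x]: there are simple [s n]
    converging to [f] in L^1(D) with integrals converging to [x].  Borel
    measurability of [f] is strong measurability as soon as [H] is separable. *)
Definition bochner_integral (D : set Omega) (f : Omega -> borel H) (x : H)
    : Prop :=
  measurable_fun D f /\
  exists s : nat -> {mfun Omega >-> borel H},
    [/\ (forall n, finite_set (range (s n))),
        (\int[P]_(w in D) (`|(f w : H) - (s n w : H)|)%:E @[n --> \oo] --> 0)%E &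
        simple_integral D (s n) @[n --> \oo] --> x].

(** [G] is a version of the conditional expectation of [T] given [W], in the
    Bochner sense; the case [D = setT] gives integrability of [T] and [G]. *)
Definition is_cond_expectation d' (E : measurableType d')
    (T : Omega -> borel H) (W : Omega -> E) (G : Omega -> borel H) : Prop :=
  (forall B, measurable B -> g_sigma_algebra_preimage W (G @^-1` B)) /\
  (forall D, g_sigma_algebra_preimage W D ->
     exists2 x : H, bochner_integral D G x & bochner_integral D T x).

End Bochner.

Section Branching.
Context (R : realType) (H : completeNormedModType R).

(** [kappa] is a regular conditional distribution of [T] given [W]. *)
Definition is_cond_kernel d (Omega : measurableType d) (P : probability Omega R)
    d' (E : measurableType d') (T : Omega -> borel H) (W : Omega -> E)
    (kappa : R.-pker E ~> borel H) : Prop :=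
  forall (A : set E) (B : set (borel H)), measurable A -> measurable B ->
    P (T @^-1` B `&` W @^-1` A) = (\int[P]_(w in W @^-1` A) kappa (W w) B)%E.

(** [mu] is a plain set function of which only the values on Borel sets matter:
    this accommodates pushforwards along maps that are Borel on [X] only, or not
    known to be Borel when the measure is finitely supported. *)
Definition has_law d (Omega : measurableType d) (P : probability Omega R)
    (S : Omega -> borel H) (mu : set (borel H) -> \bar R) : Prop :=
  forall B, measurable B -> P (S @^-1` B) = mu B.

(** The class Gamma_q(mu, nu); as [q >= 1], "at most [q] points" is phrased with
    a possibly repeating family indexed by ['I_q]. *)
Definition Gamma (q : nat) (mu nu : set (borel H) -> \bar R)
    d (Omega : measurableType d) (P : probability Omega R)
    d' (E : measurableType d')
    (S T : {mfun Omega >-> borel H}) (U : {mfun Omega >-> E}) : Prop :=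
  let W := fun w => (S w, U w) in
  [/\ has_law P S mu, has_law P T nu, standard_borel R E &
      exists2 kappa : R.-pker (borel H * E)%type ~> borel H,
        is_cond_kernel P T W kappa &
        {ae pushforward P W, forall su,
          exists t : 'I_q -> borel H, kappa su (~` range t) = 0%E}].

(** The finite branching cost B^[q]_{p,H}(nu | mu).  Conditional expectations
    being a.s. unique, the choice of the version [G] is immaterial. *)
Definition Bcost (q : nat) (p : R) (nu mu : set (borel H) -> \bar R) : \bar R :=
  ereal_inf [set c : \bar R |
    exists d (Omega : measurableType d) (P : probability Omega R)
           d' (E : measurableType d')
           (S T : {mfun Omega >-> borel H}) (U : {mfun Omega >-> E})
           (G : Omega -> borel H),
      [/\ Gamma q mu nu P S T U,
          is_cond_expectation P T (fun w => (S w, U w)) G &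
          c = (\int[P]_w ((`|(S w : H) - (G w : H)| `^ p)%:E))%E]].

(** Membership in P_p(X), the measure living on the ambient space [H]. *)
Definition in_Pp (p : R) (X : set H) (mu : probability (borel H) R) : Prop :=
  (\int[mu]_x ((`|x : H| `^ p)%:E) < +oo)%E /\ mu (~` X) = 0%E.

End Branching.

Definition is_weights (R : realType) (k : nat) (a : 'I_k -> R) : Prop :=
  (forall i, 0 <= a i) /\ \sum_(i < k) a i = 1.

(** sum_i a_i delta_{x_i}. *)
Definition atomic (R : realType) d (T : measurableType d) (k : nat)
    (a : 'I_k -> R) (x : 'I_k -> T) : set T -> \bar R :=
  fun B => (\sum_(i < k) (a i)%:E * \d_(x i) B)%E.

(** The pushforward under [v : X -> Y] of a measure concentrated on [X]. *)
Definition push_on (R : realType) (Z Y : completeNormedModType R)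
    (X : set Z) (v : Z -> Y) (mu : set (borel Z) -> \bar R)
    : set (borel Y) -> \bar R :=
  fun B => mu (X `&` v @^-1` B).

Lemma push_on_atomic (R : realType) (Z Y : completeNormedModType R)
    (X : set Z) (v : Z -> Y) (k : nat) (a : 'I_k -> R) (x : 'I_k -> Z) :
  (forall i, X (x i)) ->
  push_on X v (atomic a (x : 'I_k -> borel Z)) =
  atomic a (v \o x : 'I_k -> borel Y).
Proof.
move=> Xx; apply/funext => B; apply: eq_bigr => i _; congr (_ * _)%E.
rewrite !diracE; congr ((nat_of_bool _)%:R%:E).
by apply/idP/idP; rewrite !inE /=; [case | split].
Qed.

(* Main.v *)
Require Import Defs.
From HB Require Import structures.
From mathcomp Require Import all_boot all_order all_algebra.
From mathcomp Require Import all_classical all_reals all_analysis.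
From mathcomp Require Import sesquilinear measurable_realfun ring lra.

Set Implicit Arguments.
Unset Strict Implicit.
Unset Printing Implicit Defensive.

Import Order.TTheory GRing.Theory Num.Theory.
Import numFieldNormedType.Exports.

Local Open Scope classical_set_scope.
Local Open Scope ring_scope.

(** Call (C) the statement that [v] does not increase the distance from a point
    of [X] to a convex combination of [m] points of [X].  Both (E) and the cost
    inequality are equivalent to (C).

    (C) implies (E): by Zorn's lemma and compactness of balls in [Y] it is enough
    to extend [u] from finitely many points to one more point [x], that is, to
    find a common point of finitely many balls.  A minimiser [y] of the largest
    excess [|y - c_i|^2 - r_i^2] over the balls (found through the dual problem of
    maximising a concave quadratic form over the simplex) is a convex combination
    of the active centres, of which Caratheodory keeps [m + 1]; if the excess were
    positive, comparing variances would contradict (C).  Conversely, suppose that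
    (C) fails at [z] and the [x_i], and let [e] be the direction of
    [v z - sum_i t_i v x_i].  Let [u] map the [x_i] carrying the worst barycenter
    isometrically into [Y], with [e]-components slightly above those of the [v x_i],
    followed by the translation by [- rho e] with [rho] large.  Then [u] is
    [rho]-close to [v], but in an extension the value at [z] would be pushed above
    [v z - rho e] by [rho]-closeness and below it by the Lipschitz condition.

    (C) implies the cost inequality: replace [(S, T, U)] by
    [(v S, v T, (S, U))].  Conditionally on [(S, U)], [T] is carried by at most [q]
    points of [X], and the conditional mean is a convex combination of them.
    Conversely, the cost from a Dirac mass at [z] to [sum_i t_i delta_{x_i}] is
    exactly [|z - sum_i t_i x_i|^p]: the lower bound is Jensen's inequality. *)

(** * Inner products *)

(** Polarisation recovers the inner product from the norm, so no witness of [is_hilbert] has to be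
    carried along. *)
Definition inner (R : realType) (V : completeNormedModType R) (x y : V) : R :=
  (`|x + y| ^+ 2 - `|x - y| ^+ 2) / 4.

Section Inner.
Context (R : realType) (V : completeNormedModType R).
Implicit Types x y z : V.

Hypothesis hV : is_hilbert V.

Lemma inner_dot : exists dot : {dot V for idfun}, forall x y, inner x y = dot x y.
Proof.
have [dot hdot] := hV; exists dot => x y.
have C z t : dot z t = dot t z by rewrite [LHS]hermitian_subproof expr0 mul1r.
rewrite /inner !hdot !(linearDl, linearDr, linearNl, linearNr) /= (C y x); lra.
Qed.

Lemma innerxx x : inner x x = `|x| ^+ 2.
Proof.
rewrite /inner subrr normr0 expr0n /= -mulr2n -scaler_nat normrZ normr_nat; lra.
Qed.

Lemma innerC x y : inner x y = inner y x.
Proof. by rewrite /inner (addrC x y) (distrC x y). Qed.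

Lemma innerDl x y z : inner (x + y) z = inner x z + inner y z.
Proof. have [dot hdot] := inner_dot. by rewrite !hdot linearDl. Qed.

Lemma innerZl (a : R) x z : inner (a *: x) z = a * inner x z.
Proof. have [dot hdot] := inner_dot. by rewrite !hdot linearZl_LR. Qed.

Lemma innerDr z x y : inner z (x + y) = inner z x + inner z y.
Proof. by rewrite innerC innerDl !(innerC z). Qed.

Lemma innerZr (a : R) z x : inner z (a *: x) = a * inner z x.
Proof. by rewrite innerC innerZl !(innerC z). Qed.

Lemma innerNl x z : inner (- x) z = - inner x z.
Proof. by rewrite -scaleN1r innerZl mulN1r. Qed.

Lemma innerNr z x : inner z (- x) = - inner z x.
Proof. by rewrite innerC innerNl innerC. Qed.

Lemma innerBl x y z : inner (x - y) z = inner x z - inner y z.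
Proof. by rewrite innerDl innerNl. Qed.

Lemma innerBr z x y : inner z (x - y) = inner z x - inner z y.
Proof. by rewrite innerDr innerNr. Qed.

Lemma inner0l x : inner 0 x = 0.
Proof. by rewrite -(scale0r 0) innerZl mul0r. Qed.

Lemma inner0r x : inner x 0 = 0.
Proof. by rewrite innerC inner0l. Qed.

Lemma inner_suml I (s : seq I) (P : pred I) (F : I -> V) z :
  inner (\sum_(i <- s | P i) F i) z = \sum_(i <- s | P i) inner (F i) z.
Proof. by elim/big_rec2: _ => [|i a b _ <-]; rewrite (inner0l, innerDl). Qed.

Lemma inner_sumr I (s : seq I) (P : pred I) (F : I -> V) z :
  inner z (\sum_(i <- s | P i) F i) = \sum_(i <- s | P i) inner z (F i).
Proof. by rewrite innerC inner_suml; apply: eq_bigr => i _; rewrite innerC. Qed.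

Definition innerE := (innerDl, innerDr, innerZl, innerZr, innerNl, innerNr).

Lemma normD_sqr x y : `|x + y| ^+ 2 = `|x| ^+ 2 + 2 * inner x y + `|y| ^+ 2.
Proof. by rewrite -!innerxx !innerE (innerC y x); ring. Qed.

Lemma normB_sqr x y : `|x - y| ^+ 2 = `|x| ^+ 2 - 2 * inner x y + `|y| ^+ 2.
Proof. by rewrite normD_sqr innerNr normrN; ring. Qed.

Lemma inner_le_norm x y : inner x y <= `|x| * `|y|.
Proof.
have [->|y0] := eqVneq y 0; first by rewrite inner0r normr0 mulr0.
have [->|x0] := eqVneq x 0; first by rewrite inner0l normr0 mul0r.
have y1 : 0 < `|y| by rewrite normr_gt0.
have x1 : 0 < `|x| by rewrite normr_gt0.
have := sqr_ge0 (`| `|y| *: x - `|x| *: y|).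
rewrite normB_sqr !innerE !normrZ !normr_id => H.
have : 0 <= 2 * (`|x| * `|y|) * (`|x| * `|y| - inner x y) by nra.
by rewrite pmulr_rge0 ?subr_ge0 // !mulr_gt0.
Qed.

Lemma abs_inner_le x y : `|inner x y| <= `|x| * `|y|.
Proof.
rewrite ler_norml inner_le_norm andbT lerNl -innerNl.
by rewrite (le_trans (inner_le_norm _ _)) // normrN.
Qed.

Lemma inner_inj x y : (forall z, inner x z = inner y z) -> x = y.
Proof.
move=> /(_ (x - y)) /eqP; rewrite -subr_eq0 -innerBl innerxx sqrf_eq0 normr_eq0.
by rewrite subr_eq0 => /eqP.
Qed.

Lemma inner_continuous z : continuous (fun x : V => inner x z).
Proof.
move=> x; rewrite /inner; apply: cvgMl; apply: cvgB.
  apply: cvgM; apply: cvg_norm; apply: cvgD => //; exact: cvg_cst.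
apply: cvgM; apply: cvg_norm; apply: cvgB => //; exact: cvg_cst.
Qed.

(** Some [u n] is closer to [x - y] than [|x - y|], which contradicts Cauchy-Schwarz. Countably many
    test vectors thus determine a vector, as almost sure identities require. *)
Lemma inner_seq_inj (u : nat -> V) x y :
  (forall z e, 0 < e -> exists n, ball z e (u n)) ->
  (forall n, inner x (u n) = inner y (u n)) -> x = y.
Proof.
move=> du H; apply: contrapT => /eqP xy; pose e := `|x - y|.
have e0 : 0 < e by rewrite normr_gt0 subr_eq0.
have [n] := du (x - y) e e0; rewrite -ball_normE /= => en.
have /eqP := H n; rewrite -subr_eq0 -innerBl => /eqP H0.
have : e ^+ 2 <= e * `|x - y - u n|.
  apply: le_trans (inner_le_norm _ _); rewrite innerBr H0 subr0 innerxx //.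
by rewrite expr2 ler_pM2l // leNgt en.
Qed.

(** Decomposition into squared bias and variance. The variance is written through pairwise distances
    because those are what isometries and Lipschitz maps control. *)
Lemma variance_identity (I : finType) (s : I -> R) (c : I -> V) y :
  \sum_i s i = 1 ->
  \sum_i s i * `|y - c i| ^+ 2 =
  `|y - \sum_i s i *: c i| ^+ 2 +
  2^-1 * \sum_i \sum_j s i * s j * `|c i - c j| ^+ 2.
Proof.
move=> s1; set b := \sum_i s i *: c i; set Q := \sum_i s i * `|c i| ^+ 2.
have yb : \sum_i s i * inner y (c i) = inner y b.
  by rewrite inner_sumr; apply: eq_bigr => i _; rewrite innerZr.
have bb : \sum_i s i * inner b (c i) = inner b b.
  by rewrite [RHS]inner_sumr; apply: eq_bigr => i _; rewrite innerZr.
have -> : \sum_i s i * `|y - c i| ^+ 2 = `|y| ^+ 2 - 2 * inner y b + Q.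
  transitivity (\sum_i (s i * `|y| ^+ 2 - 2 * (s i * inner y (c i))
      + s i * `|c i| ^+ 2)).
    by apply: eq_bigr => i _; rewrite normB_sqr; ring.
  by rewrite big_split sumrB /= -mulr_suml s1 mul1r -mulr_sumr yb.
have -> : \sum_i \sum_j s i * s j * `|c i - c j| ^+ 2 = 2 * Q - 2 * inner b b.
  transitivity (\sum_i (s i * `|c i| ^+ 2 - 2 * (s i * inner b (c i)) + s i * Q)).
    apply: eq_bigr => i _.
    transitivity (\sum_j (s j * (s i * `|c i| ^+ 2) -
        2 * s i * (s j * inner (c i) (c j)) + s i * (s j * `|c j| ^+ 2))).
      by apply: eq_bigr => j _; rewrite normB_sqr; ring.
    rewrite big_split sumrB /= -mulr_suml s1 mul1r -!mulr_sumr innerC inner_sumr.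
    by under [in RHS]eq_bigr do rewrite innerZr; rewrite !mulrA.
  by rewrite big_split sumrB /= -mulr_suml s1 mul1r -mulr_sumr bb -/Q; ring.
by rewrite normB_sqr -(innerxx b); field.
Qed.

(** The Karush-Kuhn-Tucker conditions at a maximiser of a concave quadratic form. *)
Lemma quadratic_simplex_max n (al : 'I_n -> R) (c : 'I_n -> V) (t : 'I_n -> R)
    (b := \sum_i t i *: c i) (C := \sum_i t i * al i - 2 * `|b| ^+ 2) :
  is_weights t ->
  (forall s, is_weights s ->
    \sum_i s i * al i - `|\sum_i s i *: c i| ^+ 2 <=
    \sum_i t i * al i - `|\sum_i t i *: c i| ^+ 2) ->
  (forall j, al j - 2 * inner b (c j) <= C) /\
  (forall j, 0 < t j -> al j - 2 * inner b (c j) = C).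
Proof.
move=> [t0 t1] tmax; set A := \sum_i t i * al i in C tmax *.
have le j : al j - 2 * inner b (c j) <= C.
  apply/ler_addgt0Pr => d d0.
  pose N := `|c j - b| ^+ 2; have N0 : 0 <= N by exact: sqr_ge0.
  (* A fraction [e] of the mass is moved to the vertex [j]; this [e] keeps the second-order term
     [e * N] at most [d]. *)
  pose e := Num.min 1 (d / (N + 1)).
  have e0 : 0 < e by rewrite lt_min ltr01 divr_gt0 // ltr_wpDl.
  have e1 : e <= 1 by rewrite ge_min lexx.
  have eN : e * N <= d.
    apply: (@le_trans _ _ (d / (N + 1) * N)); first by rewrite ler_wpM2r // ge_min lexx orbT.
    rewrite -mulrA ger_pMr // ler_pdivrMl ?mulr1 ?lerDl //; lra.
  pose s i := (1 - e) * t i + e * (i == j)%:R.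
  have sE (W : lmodType R) (F : 'I_n -> W) :
      \sum_i s i *: F i = (1 - e) *: (\sum_i t i *: F i) + e *: F j.
    rewrite (eq_bigr (fun i => (1 - e) *: (t i *: F i) + e *: ((i == j)%:R *: F i))).
      rewrite big_split /= -!scaler_sumr; congr (_ + e *: _).
      rewrite (bigD1 j) //= eqxx scale1r big1 ?addr0 // => i /negbTE ->.
      by rewrite scale0r.
    by move=> i _; rewrite !scalerA -scalerDl.
  have ws : is_weights s.
    split=> [i|]; first by rewrite addr_ge0 // mulr_ge0 ?subr_ge0 // ltW.
    rewrite big_split /= -!mulr_sumr t1 (bigD1 j) //= eqxx big1 => [|i /negbTE -> //].
    by rewrite addr0 mulr1n !mulr1 subrK.
  have := tmax _ ws; rewrite (sE R^o al) (sE V c) -/b.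
  rewrite [X in X -> _]/(is_true ((1 - e) * A + e * al j - _ <= _ - _)).
  have -> : (1 - e) *: b + e *: c j = b + e *: (c j - b).
    by rewrite scalerBl scale1r scalerBr -addrA [- _ + _]addrC.
  rewrite normD_sqr innerZr innerBr innerxx normrZ (gtr0_norm e0) exprMn -/N => H.
  have : e * (al j - 2 * inner b (c j) - C - e * N) <= 0.
    by rewrite /C; nra.
  by rewrite pmulr_rle0 //; lra.
split=> // j tj.
(* Complementary slackness: the slacks are nonnegative and their [t]-average vanishes. *)
have : \sum_i t i * (C - (al i - 2 * inner b (c i))) = 0.
  transitivity (\sum_i (t i * C - t i * al i + 2 * inner b (t i *: c i))).
    by apply: eq_bigr => i _; rewrite innerZr; ring.
  rewrite big_split sumrB /= -mulr_suml t1 -mulr_sumr -inner_sumr innerxx /C -/A; ring.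
move/eqP; rewrite psumr_eq0 => [|i _]; last by rewrite mulr_ge0 // subr_ge0.
move=> /allP /(_ j (mem_index_enum _)); rewrite mulf_eq0 (gt_eqF tj) /= subr_eq0.
by move/eqP.
Qed.

End Inner.

(** * Simplices and orthonormal families *)

Section Simplex.
Context (R : realType).

Lemma continuous_sum (T : topologicalType) (V : normedModType R) I (s : seq I)
    (F : I -> T -> V) :
  (forall i, continuous (F i)) -> continuous (fun x => \sum_(i <- s) F i x).
Proof.
move=> cF x; elim: s => [|i s IH].
  by under eq_fun do rewrite big_nil; exact: cvg_cst.
under eq_fun do rewrite big_cons; apply: cvgD => //; exact: cF.
Qed.

Lemma coord_row_continuous n (i : 'I_n) : continuous (fun t : 'rV[R]_n => t ord0 i).
Proof. exact: coord_continuous. Qed.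

(** The simplex is closed in a cube, hence compact; the index [n.+1] makes it nonempty. *)
Lemma simplex_max n (F : ('I_n.+1 -> R) -> R) :
  continuous (fun t : 'rV[R]_n.+1 => F (t ord0)) ->
  exists2 a, is_weights a & forall b, is_weights b -> F b <= F a.
Proof.
move=> cF; pose A : set 'rV[R]_n.+1 := [set t | is_weights (t ord0)].
have rowE (b : 'I_n.+1 -> R) : (\row_i b i) ord0 = b by apply/funext => i; rewrite mxE.
have A0 : A !=set0.
  exists (\row_i (i == ord0)%:R); rewrite /A /= rowE; split=> [i|]; first exact: ler0n.
  by rewrite (bigD1 ord0) //= big1 ?addr0 // => i /negbTE ->.
have clA : closed A.
  have -> : A = \bigcap_(i in [set: 'I_n.+1]) [set t : 'rV[R]_n.+1 | 0 <= t ord0 i]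
      `&` [set t : 'rV[R]_n.+1 | \sum_i t ord0 i = 1].
    by apply/seteqP; split=> t /= [a b]; split=> // i; [move=> _|]; apply: a.
  apply: closedI.
    apply: closed_bigI => i _.
    exact: ((continuous_closedP _).1 (@coord_row_continuous _ i) _ (@closed_ge _ 0)).
  have cs : continuous (fun t : 'rV[R]_n.+1 => \sum_i t ord0 i).
    by apply: (@continuous_sum _ R^o) => i; exact: coord_row_continuous.
  exact: ((continuous_closedP _).1 cs _ (@closed_eq _ 1)).
have cA : compact A.
  apply: (@subclosed_compact _ _ [set t : 'rV[R]_n.+1 | forall i, t ord0 i \in `[0, 1]]) => //.
    by apply: (@rV_compact _ _ (fun=> `[0 : R, 1]%classic)) => _; apply: segment_compact.
  move=> t [t0 t1] i; rewrite in_itv /= t0 -t1 (bigD1 i) //= lerDl.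
  by apply: sumr_ge0.
have [c /set_mem cA' cmax] := compact_EVT_max A0 cA (continuous_subspaceT cF).
exists (c ord0) => // b wb; rewrite -(rowE b); apply: cmax; apply/mem_set.
by rewrite /A /= rowE.
Qed.

(** Appending a coordinate 1 to each point turns affine dependence into linear dependence of more
    than [m + 1] vectors in dimension [m + 1]. *)
Lemma affine_dependence m n (c : 'I_n -> 'rV[R]_m) (P : pred 'I_n) :
  (m.+1 < #|P|)%N ->
  exists be : 'I_n -> R, [/\ exists i, be i != 0, forall i, be i != 0 -> P i,
    \sum_i be i = 0 & \sum_i be i *: c i = 0].
Proof.
move=> mP; pose B := \matrix_(k < #|P|) row_mx (c (enum_val k)) (const_mx 1 : 'rV[R]_1).
have : kermx B != 0.
  rewrite kermx_eq0 /row_free neq_ltn (leq_ltn_trans (rank_leq_col _)) //.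
  by rewrite addn1.
move=> /rowV0Pn [u /sub_kermxP uB u0].
pose be i := \sum_k u ord0 k * (enum_val k == i)%:R.
have beE (W : lmodType R) (F : 'I_n -> W) :
    \sum_i be i *: F i = \sum_k u ord0 k *: F (enum_val k).
  under eq_bigr do rewrite scaler_suml.
  rewrite exchange_big /=; apply: eq_bigr => k _.
  rewrite (bigD1 (enum_val k)) //= eqxx mulr1 big1 ?addr0 // => i.
  by rewrite eq_sym => /negbTE ->; rewrite mulr0 scale0r.
have beV k : be (enum_val k) = u ord0 k.
  rewrite /be (bigD1 k) //= eqxx mulr1 big1 ?addr0 // => i ik.
  by rewrite (inj_eq enum_val_inj) (negbTE ik) mulr0.
exists be; split.
- have [k uk] : exists k, u ord0 k != 0.
    apply/existsP; apply: contraNT u0; rewrite negb_exists => /forallP H.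
    by apply/eqP/rowP => k; rewrite mxE; apply/eqP; move: (H k); rewrite negbK.
  by exists (enum_val k); rewrite beV.
- move=> i bi; apply: contraNT bi => Pi; rewrite /be big1 // => k _.
  have [ki|] := eqVneq (enum_val k) i; last by rewrite mulr0.
  by have := enum_valP k; rewrite ki unfold_in (negbTE Pi).
- have := congr1 (fun w : 'rV[R]_(m + 1) => w ord0 (rshift m ord0)) uB.
  rewrite !mxE => H; transitivity (\sum_i be i *: (1 : R^o)).
    by apply: eq_bigr => i _; rewrite [RHS]mulr1.
  by rewrite (beE R^o) -[RHS]H; apply: eq_bigr => k _; rewrite mxE row_mxEr mxE.
- rewrite beE; apply/rowP => j.
  have := congr1 (fun w : 'rV[R]_(m + 1) => w ord0 (lshift 1 j)) uB.
  rewrite !mxE summxE => H; rewrite -[RHS]H.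
  by apply: eq_bigr => k _; rewrite mxE [B k _]mxE row_mxEl.
Qed.

(** Shifting the weights along an affine dependence until one of them vanishes shrinks the support;
    induction on its size. *)
Lemma caratheodory m n (c : 'I_n -> 'rV[R]_m) (t : 'I_n -> R) : is_weights t ->
  exists s : 'I_n -> R, [/\ is_weights s, forall i, s i != 0 -> t i != 0,
    \sum_i s i *: c i = \sum_i t i *: c i & (#|[pred i | s i != 0%R]| <= m.+1)%N].
Proof.
have [k] := ubnP #|[pred i | t i != 0]|; elim: k t => // k IH t tk wt.
have [le|lt] := leqP #|[pred i | t i != 0]| m.+1; first by exists t.
have [be [[i1 bi1] beP be0 bec]] := affine_dependence c lt.
have [t0 t1] := wt.
have [i2 bi2] : exists i, 0 < be i.
  apply: contrapT => H.
  have ble i : be i <= 0 by rewrite leNgt; apply/negP => b; apply: H; exists i.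
  have : \sum_i - be i == 0 by rewrite sumrN be0 oppr0.
  rewrite psumr_eq0 => [/allP /(_ i1 (mem_index_enum _))|i _]; last by rewrite oppr_ge0.
  by rewrite oppr_eq0 (negbTE bi1).
(* The smallest ratio is the longest admissible shift: all weights stay nonnegative and that of [i0]
   becomes zero. *)
case: (@arg_minP _ _ _ i2 (fun i => 0 < be i) (fun i => t i / be i) bi2) => i0 b0 min0.
pose r := t i0 / be i0; have r0 : 0 <= r by rewrite divr_ge0 // ltW.
pose s i := t i - r * be i.
have sE (W : lmodType R) (F : 'I_n -> W) : \sum_i be i *: F i = 0 ->
    \sum_i s i *: F i = \sum_i t i *: F i.
  move=> H; transitivity (\sum_i t i *: F i - r *: \sum_i be i *: F i).
    by rewrite scaler_sumr -sumrB; apply: eq_bigr => i _; rewrite scalerBl scalerA.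
  by rewrite H scaler0 subr0.
have ws : is_weights s.
  split=> [i|].
    rewrite subr_ge0; have [bi|bi] := ltP 0 (be i).
      by rewrite -ler_pdivlMr //; exact: min0.
    exact: le_trans (mulr_ge0_le0 r0 bi) (t0 i).
  by rewrite sumrB t1 -mulr_sumr be0 mulr0 subr0.
have st i : s i != 0 -> t i != 0.
  apply: contraNneq => ti; rewrite /s ti sub0r oppr_eq0 mulf_eq0; apply/orP; right.
  by apply: contraTT isT => /beP /=; rewrite ti eqxx.
have [|//|s' [ws' s's s'c s'm]] := IH s.
  rewrite -ltnS; apply: leq_trans tk; rewrite ltnS; apply: proper_card.
  apply/properP; split; first by apply/fintype.subsetP => i; rewrite !inE; exact: st.
  exists i0; first by rewrite inE; apply: beP; rewrite gt_eqF.
  by rewrite inE negbK /s /r divfK ?(gt_eqF b0) // subrr.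
exists s'; split=> // [i /s's/st //|]; by rewrite s'c sE.
Qed.

(** Cholesky factorisation: [a] is the pivot, [b] the rest of its row, and the induction applies to
    the Schur complement [D i j - b i * b j / a]. *)
Lemma gram_factor n (M : 'I_n -> 'I_n -> R) : (forall i j, M i j = M j i) ->
  (forall u : 'I_n -> R, 0 <= \sum_i \sum_j u i * u j * M i j) ->
  exists C : 'I_n -> 'I_n -> R, forall i j, M i j = \sum_k C i k * C j k.
Proof.
elim: n M => [|n IH] M sM pM; first by exists (fun _ _ => 0) => -[].
pose l := lift (@ord0 n); pose a := M ord0 ord0; pose b i := M ord0 (l i).
pose D i j := M (l i) (l j).
have qE s (w : 'I_n -> R) : 0 <= s ^+ 2 * a + 2 * s * (\sum_j w j * b j)
    + \sum_i \sum_j w i * w j * D i j.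
  have := pM (fun i => if unlift ord0 i is Some j then w j else s).
  rewrite big_ord_recl big_ord_recl unlift_none -/a.
  under eq_bigr do rewrite liftK.
  under [X in _ + X]eq_bigr do rewrite big_ord_recl unlift_none liftK.
  under [X in _ + X]eq_bigr do under eq_bigr do rewrite liftK.
  rewrite big_split /= => H; apply: le_trans H _; rewrite le_eqVlt; apply/orP; left.
  apply/eqP; rewrite mulr_sumr.
  rewrite [in RHS](eq_bigr (fun j => s * w j * b j + w j * s * M (lift ord0 j) ord0)).
    by rewrite big_split /= /b /D; ring.
  by move=> j _; rewrite (sM (lift _ _)) -/(b j); ring.
have a0 : 0 <= a.
  have := qE 1 (fun=> 0); rewrite expr1n mul1r.
  rewrite [X in _ + _ * X]big1 => [|i _]; last by rewrite mul0r.
  by rewrite [X in _ + X]big1 => [|i _]; rewrite ?mulr0 ?addr0 // big1 // => j _; rewrite !mul0r.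
(* With a zero pivot, a nonzero [b j] would let the form take the value -1. *)
have b0 : a = 0 -> forall j, b j = 0.
  move=> az j; apply: contrapT => /eqP bj.
  have := qE (- (D j j + 1) / (2 * b j)) (fun i => (i == j)%:R).
  rewrite az mulr0 add0r (bigD1 j) //= eqxx big1 => [|i /negbTE ->]; last by rewrite mul0r.
  rewrite (bigD1 j) //= (bigD1 j) //= eqxx big1 => [|i /negbTE ->]; last by rewrite mulr0 mul0r.
  rewrite big1 => [|i /negbTE ->]; last by rewrite big1 // => k _; rewrite !mul0r.
  have -> : 2 * (- (D j j + 1) / (2 * b j)) * (true%:R * b j + 0) +
      (true%:R * true%:R * D j j + 0 + 0) = -1 :> R.
    by rewrite mulr1n; field.
  by rewrite oppr_ge0 ler10.
have [|u|C' HC] := IH (fun i j => D i j - b i * b j / a).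
- by move=> i j; rewrite /D sM [b j * _]mulrC.
(* For [a > 0] this value of [s] minimises the form, and the minimum is the form of the Schur
   complement; for [a = 0] both quotients by [a] are 0. *)
- have := qE (- (\sum_j u j * b j) / a) u => H; apply: le_trans H _.
  rewrite le_eqVlt; apply/orP; left; apply/eqP; set W := \sum_j u j * b j.
  transitivity ((\sum_i \sum_j u i * u j * D i j) - W * W / a).
    have [->|az] := eqVneq a 0; first by rewrite invr0 !mulr0 mul0r; ring.
    by field.
  have -> : W * W / a = \sum_i \sum_j u i * b i * (u j * b j) / a.
    rewrite {1}/W !mulr_suml; apply: eq_bigr => i _.
    by rewrite /W mulr_sumr mulr_suml.
  rewrite -sumrB; apply: eq_bigr => i _.
  by rewrite -sumrB; apply: eq_bigr => j _; ring.
pose q := Num.sqrt a; have qq : q * q = a by rewrite -expr2 sqr_sqrtr.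
exists (fun i k => match unlift ord0 i, unlift ord0 k with
  | None, None => q | None, Some _ => 0
  | Some i, None => b i / q | Some i, Some k => C' i k end) => i j.
have bq k : b k / q * q = b k.
  have [q0|q0] := eqVneq q 0; last by rewrite divfK.
  by rewrite q0 mulr0 b0 // -qq q0 mulr0.
rewrite big_ord_recl unlift_none.
case: (unliftP ord0 i) => [i'|] ->; case: (unliftP ord0 j) => [j'|] ->.
- under eq_bigr do rewrite liftK.
  have := HC i' j'; rewrite -/(D i' j') => <-; rewrite -qq invfM; ring.
- by rewrite big1 ?addr0 => [|k _]; rewrite ?liftK ?mulr0 // bq sM.
- by rewrite big1 ?addr0 => [|k _]; rewrite ?liftK ?mul0r // mulrC bq.
- by rewrite big1 ?addr0 => [|k _]; rewrite ?liftK ?mul0r // qq.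
Qed.

End Simplex.

Section Orthonormal.
Context (R : realType) (Y : completeNormedModType R) (m : nat).
Hypotheses (hY : is_hilbert Y) (dimY : dim_eq Y m).

(** Only the values of [o] below [k] matter. *)
Definition is_orthonormal k (o : nat -> Y) :=
  forall i j, (i < k)%N -> (j < k)%N -> inner (o i) (o j) = (i == j)%:R.

(** A nonzero left kernel vector of the [m] by [k] matrix [B] gives a combination of basis vectors
    orthogonal to every [o i]. *)
Lemma orthonormal_extend k (o : nat -> Y) : is_orthonormal k o -> (k < m)%N ->
  exists y, [/\ `|y| = 1 & forall i, (i < k)%N -> inner y (o i) = 0].
Proof.
move=> oo km; have [f [g fg gf]] := dimY.
pose B := \matrix_(i < m, j < k) inner (g (delta_mx ord0 i)) (o j).
have : kermx B != 0.
  by rewrite kermx_eq0 /row_free neq_ltn (leq_ltn_trans (rank_leq_col _)).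
move=> /rowV0Pn [u /sub_kermxP uB u0].
have fgu : f (\sum_i u ord0 i *: g (delta_mx ord0 i)) = u.
  rewrite linear_sum /= [RHS]row_sum_delta; apply: eq_bigr => i _.
  by rewrite linearZ /= gf.
set y := \sum_i _ in fgu.
have y0 : y != 0 by apply: contraNneq u0 => y0; rewrite -fgu y0 linear0.
exists (`|y|^-1 *: y); split=> [|i ik].
  by rewrite normrZ normfV normr_id mulVf // normr_eq0.
rewrite innerZl // inner_suml //.
have := congr1 (fun w : 'rV[R]_k => w ord0 (Ordinal ik)) uB; rewrite !mxE => H.
rewrite [X in _ * X](_ : _ = 0) ?mulr0 // -[RHS]H.
by apply: eq_bigr => j _; rewrite innerZl // mxE.
Qed.

Lemma orthonormal_leq_dim k (o : nat -> Y) : is_orthonormal k o -> (k <= m)%N.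
Proof.
move=> oo; have [f [g fg gf]] := dimY; rewrite leqNgt; apply/negP => mk.
pose B := \matrix_(i < k) f (o i).
have : kermx B != 0.
  by rewrite kermx_eq0 /row_free neq_ltn (leq_ltn_trans (rank_leq_col _)).
move=> /rowV0Pn [u /sub_kermxP uB /eqP[]]; apply/rowP => i; rewrite mxE.
have y0 : \sum_j u ord0 j *: o j = 0.
  apply: (can_inj fg); rewrite linear0 -[RHS]uB linear_sum mulmx_sum_row /=.
  by apply: eq_bigr => j _; rewrite linearZ /= rowK.
have := congr1 (fun y => inner y (o i)) y0; rewrite inner0l // inner_suml //.
rewrite (bigD1 i) //= innerZl // oo // eqxx mulr1 big1 ?addr0 // => j ji.
by rewrite innerZl // oo // (inj_eq val_inj) (negbTE ji) mulr0.
Qed.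

Lemma orthonormal_complete e : `|e| = 1 -> (0 < m)%N ->
  exists2 o : nat -> Y, is_orthonormal m o & o 0%N = e.
Proof.
move=> e1; case: m orthonormal_extend => // n ext _.
suff H k : (k <= n)%N -> exists2 o : nat -> Y, is_orthonormal k.+1 o & o 0%N = e by exact: H.
elim: k => [_|k IH kn].
  by exists (fun=> e) => // -[|i] [|j] // _ _; rewrite innerxx // e1 expr1n.
have [w ow w0] := IH (ltnW kn); have [y [y1 yo]] := ext _ _ ow kn.
exists (fun i => if i == k.+1 then y else w i) => // i j.
rewrite !ltnS leq_eqVlt => /orP[/eqP ->|ik]; rewrite leq_eqVlt => /orP[/eqP ->|jk].
- by rewrite eqxx innerxx // y1 expr1n.
- by rewrite eqxx (ltn_eqF jk) yo // (gtn_eqF jk).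
- by rewrite eqxx (ltn_eqF ik) innerC yo.
- by rewrite (ltn_eqF ik) (ltn_eqF jk) ow.
Qed.

(** A nonzero remainder, once normalised, would be one orthonormal vector too many. *)
Lemma orthonormal_expand (o : nat -> Y) y : is_orthonormal m o ->
  y = \sum_(i < m) inner y (o i) *: o i.
Proof.
move=> oo; apply/eqP; rewrite -subr_eq0; apply: contraT => r0.
set r := y - _ in r0.
have ro i : (i < m)%N -> inner r (o i) = 0.
  move=> im; rewrite /r innerBl // inner_suml // (bigD1 (Ordinal im)) //= innerZl //.
  rewrite oo // eqxx mulr1 big1 ?addr0 ?subrr // => j jm.
  by rewrite innerZl // oo // -[i]/(val (Ordinal im)) (inj_eq val_inj) (negbTE jm) mulr0.
have : is_orthonormal m.+1 (fun i => if i == m then `|r|^-1 *: r else o i).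
  move=> i j; rewrite !ltnS leq_eqVlt => /orP[/eqP ->|ik]; rewrite leq_eqVlt => /orP[/eqP ->|jk].
  - by rewrite !eqxx innerxx // normrZ normfV normr_id mulVf ?normr_eq0 // expr1n.
  - by rewrite eqxx (ltn_eqF jk) innerZl // ro // (gtn_eqF jk) mulr0.
  - by rewrite eqxx (ltn_eqF ik) innerC innerZl // ro // mulr0.
  - by rewrite (ltn_eqF ik) (ltn_eqF jk) oo.
by move=> /orthonormal_leq_dim; rewrite ltnn.
Qed.

Lemma exists_unit : (0 < m)%N -> exists e : Y, `|e| = 1.
Proof.
move=> m0; have [//|e [e1 _]] := @orthonormal_extend 0 (fun=> 0) _ m0.
by exists e.
Qed.

Lemma orthonormal_basis : (0 < m)%N -> exists o : nat -> Y, is_orthonormal m o.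
Proof.
by move=> m0; have [e e1] := exists_unit m0; have [w] := orthonormal_complete e1 m0; exists w.
Qed.

End Orthonormal.

(** * From barycenters to property (E) *)

Lemma lipschitz1P (R : realType) (Z Y : normedModType R) (A : set Z) (u : Z -> Y) :
  1.-lipschitz_A u <-> forall x y, A x -> A y -> `|u x - u y| <= `|x - y|.
Proof.
split=> [H x y Ax Ay|H [x y] [Ax Ay] /=]; last by rewrite mul1r; exact: H.
by have := H (x, y) (conj Ax Ay); rewrite /= mul1r.
Qed.

(** Condition (C) with [q] points. Counting nonzero weights instead of indices accepts families of
    any length, such as those thinned out by Caratheodory. *)
Definition contracts_barycenters (R : realType) (Z Y : completeNormedModType R)
    (X : set Z) (v : Z -> Y) (q : nat) : Prop :=
  forall n (x : 'I_n -> Z) (t : 'I_n -> R) z,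
    X z -> (forall i, X (x i)) -> is_weights t ->
    (#|[pred i | t i != 0%R]| <= q)%N ->
    `|v z - \sum_i t i *: v (x i)| <= `|z - \sum_i t i *: x i|.

Section Contraction.
Context (R : realType) (Z Y : completeNormedModType R) (X : set Z) (v : Z -> Y).

Lemma contracts_barycenters_reindex q :
  (forall (x : 'I_q -> Z) (t : 'I_q -> R) z,
    X z -> (forall i, X (x i)) -> is_weights t ->
    `|v z - \sum_i t i *: v (x i)| <= `|z - \sum_i t i *: x i|) ->
  contracts_barycenters X v q.
Proof.
move=> H n x t z Xz Xx [t0 t1] tq; set P := [pred i | _] in tq.
have [i0 _|P0] := pickP P; last first.
  move: t1; rewrite big1 => [/esym/eqP|i _]; first by rewrite oner_eq0.
  by move/negbT: (P0 i); rewrite inE negbK => /eqP.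
(* The support is enumerated and padded to length [q]: past its end [idx] takes the default [i0] and
   [s] the weight zero. *)
pose idx (j : 'I_q) := nth i0 (enum P) j.
pose s (j : 'I_q) := if (j < #|P|)%N then t (idx j) else 0.
have sE (W : lmodType R) (F : 'I_n -> W) :
    \sum_j s j *: F (idx j) = \sum_i t i *: F i.
  transitivity (\sum_(j < q | (j < #|P|)%N) t (idx j) *: F (idx j)).
    rewrite [RHS]big_mkcond /=; apply: eq_bigr => j _; rewrite /s.
    by case: ifP => // _; rewrite scale0r.
  rewrite -(big_ord_widen _ (fun j => t (nth i0 (enum P) j) *: F (nth i0 (enum P) j)) tq).
  transitivity (\sum_(i <- enum P) t i *: F i).
    by rewrite (big_nth i0) -cardE big_mkord.
  rewrite big_enum /= big_mkcond /=; apply: eq_bigr => i _.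
  by case: ifPn => //; rewrite inE negbK => /eqP ->; rewrite scale0r.
have := H (x \o idx) s z Xz (fun=> Xx _).
rewrite (sE _ (fun i => v (x i))) (sE _ x); apply; split=> [j|].
  by rewrite /s; case: ifP.
transitivity (\sum_j s j *: (1 : R^o)); first by apply: eq_bigr => j _; rewrite [RHS]mulr1.
rewrite (sE R^o (fun=> 1)) -[RHS]t1; apply: eq_bigr => j _; exact: mulr1.
Qed.

Lemma contracts_barycentersW q q' : (q <= q')%N ->
  contracts_barycenters X v q' -> contracts_barycenters X v q.
Proof. by move=> qq H n x t z Xz Xx wt tq; apply: H => //; exact: leq_trans qq. Qed.

Lemma contracts_lipschitz q : (0 < q)%N -> contracts_barycenters X v q ->
  1.-lipschitz_X v.
Proof.
move=> q0 H; apply/lipschitz1P => x y Xx Xy.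
have := H 1%N (fun=> y) (fun=> 1) x Xx (fun=> Xy); rewrite !big_ord1 !scale1r; apply.
  by split=> //; rewrite big_ord1.
by apply: leq_trans (max_card _) _; rewrite card_ord.
Qed.

End Contraction.

Section Extension.
Context (R : realType) (Z Y : completeNormedModType R) (m : nat) (X : set Z) (v : Z -> Y).
Hypotheses (hZ : is_hilbert Z) (hY : is_hilbert Y) (dimY : dim_eq Y m).
Hypothesis vX : contracts_barycenters X v m.

Lemma caratheodory_dim n (c : 'I_n -> Y) (t : 'I_n -> R) : is_weights t ->
  exists s : 'I_n -> R, [/\ is_weights s, forall i, s i != 0 -> t i != 0,
    \sum_i s i *: c i = \sum_i t i *: c i & (#|[pred i | s i != 0%R]| <= m.+1)%N].
Proof.
move=> wt; have [f bf] := dimY.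
have [s [ws st sc sm]] := caratheodory (f \o c) wt; exists s; split=> //.
apply: (bij_inj bf); rewrite !linear_sum /=.
by under eq_bigr do rewrite linearZ; under [RHS]eq_bigr do rewrite linearZ.
Qed.

Lemma finite_ball_inter n (a : 'I_n -> Z) (c : 'I_n -> Y) x rho :
  X x -> (forall i, X (a i)) -> 0 <= rho ->
  (forall i j, `|c i - c j| <= `|a i - a j|) ->
  (forall i, `|c i - v (a i)| <= rho) ->
  exists y, `|y - v x| <= rho /\ forall i, `|y - c i| <= `|x - a i|.
Proof.
move=> Xx Xa rho0 cl cv.
(* Index 0 stands for the ball of radius [rho] about [v x], so that closeness to [v] is one ball
   condition among the others. *)
pose C (j : 'I_n.+1) := if unlift ord0 j is Some i then c i else v x.
pose r (j : 'I_n.+1) := if unlift ord0 j is Some i then `|x - a i| else rho.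
pose al j := `|C j| ^+ 2 - r j ^+ 2.
(* [phi] is the dual of minimising [max_j |y - C j|^2 - r j^2] over [y], and its
   maximum [d] is the least excess. *)
pose phi (t : 'I_n.+1 -> R) := \sum_i t i * al i - `|\sum_i t i *: C i| ^+ 2.
have cphi : continuous (fun t : 'rV[R]_n.+1 => phi (t ord0)).
  have c1 : continuous (fun t : 'rV[R]_n.+1 => \sum_i t ord0 i * al i).
    apply: (@continuous_sum _ _ R^o _ _
      (fun i (t : 'rV[R]_n.+1) => t ord0 i *: (al i : R^o))) => i t.
    by apply: continuousZl; exact: coord_row_continuous.
  have c2 : continuous (fun t : 'rV[R]_n.+1 => `|\sum_i t ord0 i *: C i|).
    move=> t; apply: continuous_comp; last exact: norm_continuous.
    apply: continuous_sum => i {}t; apply: continuousZl.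
    exact: coord_row_continuous.
  by move=> t; exact: (continuousB (c1 t) (continuousM (c2 t) (c2 t))).
have [t wt tmax] := simplex_max cphi.
have [] := quadratic_simplex_max hY wt tmax.
set y := \sum_i t i *: C i; set K := _ - _ => le eq.
pose d := phi t; have Kd : K + `|y| ^+ 2 = d by rewrite /K /d /phi -/y; ring.
have distE j : `|y - C j| ^+ 2 - r j ^+ 2 = al j - 2 * inner y (C j) + `|y| ^+ 2.
  by rewrite normB_sqr // /al; ring.
have [d0|d0] := lerP d 0.
  have H j : `|y - C j| <= r j.
    rewrite -ler_sqr ?nnegrE //; last by rewrite /r; case: unlift.
    by rewrite -subr_le0 distE (le_trans _ d0) // -Kd lerD2r.
  exists y; split=> [|i]; first by have := H ord0; rewrite /C /r unlift_none.
  by have := H (lift ord0 i); rewrite /C /r liftK.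
exfalso.
(* The least excess [d] is now positive. All centres of positive weight are active, hence so are the
   at most [m + 1] centres kept here. *)
have [s [[s0 s1] st sy sm]] := caratheodory_dim C wt.
rewrite -/y in sy.
have act j : s j != 0 -> `|y - C j| ^+ 2 = r j ^+ 2 + d.
  move=> /st tj; have tj0 : 0 < t j by rewrite lt0r tj (proj1 wt).
  by have := distE j; rewrite eq // Kd; lra.
pose l := lift (@ord0 n); pose s00 := s ord0.
have s0le : s00 <= 1 by rewrite -s1 (bigD1 ord0) //= lerDl sumr_ge0.
have C0 : C ord0 = v x by rewrite /C unlift_none.
have r0 : r ord0 = rho by rewrite /r unlift_none.
have Cl i : C (l i) = c i by rewrite /C liftK.
have rl i : r (l i) = `|x - a i| by rewrite /r liftK.
have s1' : s00 + \sum_i s (l i) = 1 by rewrite -s1 big_ord_recl.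
have sy' : s00 *: v x + \sum_i s (l i) *: c i = y.
  by rewrite -sy big_ord_recl C0; congr (_ + _); apply: eq_bigr => i _; rewrite Cl.
(* If all the weight sits at [v x], then [y = v x] has excess [- rho ^+ 2] there, which is not
   positive. *)
have [s01|s01] := eqVneq s00 1.
  have z i : s (l i) = 0.
    have : \sum_i s (l i) == 0 by apply/eqP; lra.
    rewrite psumr_eq0 // => /allP /(_ i (mem_index_enum _)) /eqP; exact.
  have yv : y = v x.
    by rewrite -sy' big1 ?addr0 ?s01 ?scale1r // => i _; rewrite z scale0r.
  have := act ord0; rewrite -/s00 s01 oner_eq0 => /(_ isT).
  rewrite C0 yv subrr normr0 expr0n /= r0 => /eqP; rewrite eq_sym gt_eqF //.
  by rewrite ltr_wpDl // sqr_ge0.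
have s0lt : 0 < 1 - s00 by rewrite subr_gt0 lt_neqAle s01.
pose w i := s (l i) / (1 - s00).
have ww : is_weights w.
  split=> [i|]; first by rewrite divr_ge0 // ltW.
  by rewrite -mulr_suml (_ : \sum_i s (l i) = 1 - s00) ?divff ?gt_eqF //; lra.
have [w0 w1] := ww.
pose ub := \sum_i w i *: c i; pose ab := \sum_i w i *: a i; pose vb := \sum_i w i *: v (a i).
have yE : y = s00 *: v x + (1 - s00) *: ub.
  rewrite -sy'; congr (_ + _); rewrite scaler_sumr; apply: eq_bigr => i _.
  by rewrite scalerA /w mulrC divfK // gt_eqF.
have Vu := variance_identity hY c y w1; have Va := variance_identity hZ a x w1.
rewrite -/ub in Vu; rewrite -/ab in Va.
(* After averaging the active equalities with weights [w], the variance identity at [y] and at [x]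
   compares the biases, as the [c i] are no farther apart than the [a i]. *)
have far : `|x - ab| ^+ 2 + d <= `|y - ub| ^+ 2.
  have H : \sum_i w i * `|y - c i| ^+ 2 = \sum_i w i * `|x - a i| ^+ 2 + d.
    rewrite -[d]mul1r -[1 in RHS]w1 mulr_suml -big_split /=; apply: eq_bigr => i _.
    have [wi|wi] := eqVneq (w i) 0; first by rewrite wi !mul0r addr0.
    rewrite -mulrDr -rl -act ?Cl //; apply: contraNneq wi => sli.
    by rewrite /w sli mul0r.
  have le2 : \sum_i \sum_j w i * w j * `|c i - c j| ^+ 2 <=
             \sum_i \sum_j w i * w j * `|a i - a j| ^+ 2.
    apply: ler_sum => i _; apply: ler_sum => j _; apply: ler_wpM2l.
      exact: mulr_ge0.
    by rewrite ler_sqr ?nnegrE.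
  move: H; rewrite Vu Va; lra.
have [s00z|s00z] := eqVneq s00 0.
  move: far; rewrite yE s00z scale0r add0r subr0 scale1r subrr normr0 expr0n /=.
  by rewrite leNgt ltr_wpDl // sqr_ge0.
have yv : `|y - v x| ^+ 2 = rho ^+ 2 + d by rewrite -C0 -r0 act.
(* [y] lies on the segment from [v x] to [ub]. *)
have split_norm : `|ub - v x| = `|y - ub| + `|y - v x|.
  have -> : y - ub = s00 *: (v x - ub).
    by rewrite yE scalerBl scale1r [RHS]scalerBr addrA addrAC addrK.
  have -> : y - v x = (1 - s00) *: (ub - v x).
    by rewrite yE addrAC -{2}[v x]scale1r -scalerBl -opprB scaleNr addrC -scalerBr.
  rewrite !normrZ (ger0_norm (s0 _)) (gtr0_norm s0lt) (distrC (v x)) -mulrDl.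
  by rewrite [s00 + _]addrC subrK mul1r.
(* Through [vb]: [rho]-closeness bounds [|ub - vb|] and (C) bounds [|vb - v x|]. *)
have uv : `|ub - v x| <= rho + `|x - ab|.
  have -> : ub - v x = (ub - vb) + (vb - v x) by rewrite addrA subrK.
  apply: le_trans (ler_normD _ _) _; apply: lerD.
    rewrite /ub /vb -sumrB; apply: le_trans (ler_norm_sum _ _ _) _.
    rewrite -[rho]mul1r -w1 mulr_suml; apply: ler_sum => i _.
    by rewrite -scalerBr normrZ ger0_norm // ler_wpM2l.
  rewrite distrC; apply: vX => //.
  (* Index 0 takes one of the [m + 1] places in the support of [s], so that [w] has at most [m]
     nonzero weights. *)
  have : (#|[pred i | w i != 0%R]|.+1 <= #|[pred j | s j != 0%R]|)%N.
    rewrite -(fintype.card_image (@lift_inj _ ord0)).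
    have : [seq lift ord0 i | i in [pred i | w i != 0]] \subset
        [predD1 [pred j | s j != 0] & ord0].
      apply/fintype.subsetP => j /fintype.imageP [i]; rewrite inE => wi ->.
      rewrite !inE; apply/andP; split=> //; apply: contraNneq wi => sli.
      by rewrite /w /l sli mul0r.
    move=> /subset_leq_card H; apply: leq_ltn_trans H _.
    by rewrite [X in (_ < X)%N](cardD1 ord0) inE s00z.
  by move=> H; rewrite -ltnS (leq_trans H).
(* Both pieces of the segment exceed their bounds, against [uv]. *)
have n1 : `|x - ab| < `|y - ub|.
  by rewrite -ltr_sqr ?nnegrE // (lt_le_trans _ far) // ltrDl.
have n2 : rho < `|y - v x| by rewrite -ltr_sqr ?nnegrE // yv ltrDl.
by move: uv; rewrite split_norm leNgt addrC ltrD.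
Qed.

(** Orthonormal coordinates identify [Y] with row vectors, where the ball about [v x] is compact;
    the finite intersection property reduces the claim to finitely many points. *)
Lemma one_point_extension (A : set Z) (u : Z -> Y) rho x : (0 < m)%N ->
  A `<=` X -> X x -> 0 <= rho ->
  (forall a b, A a -> A b -> `|u a - u b| <= `|a - b|) ->
  (forall a, A a -> `|u a - v a| <= rho) ->
  exists y, `|y - v x| <= rho /\ forall a, A a -> `|y - u a| <= `|x - a|.
Proof.
move=> m0 AX Xx rho0 ul uv.
(* The compact set [K] enters the family only through its intersections with the [F a], so an empty
   [A] is treated apart. *)
have [[a0 Aa0]|nA] := pselect (exists a, A a); last first.
  by exists (v x); rewrite subrr normr0; split=> // a Aa; case: nA; exists a.
have [w ow] := orthonormal_basis hY dimY m0.
pose g (t : 'rV[R]_m) : Y := \sum_i t ord0 i *: w i.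
have cg y : continuous (fun t => `|g t - y|).
  have cg0 : continuous g.
    by apply: continuous_sum => i t; apply: continuousZl; exact: coord_row_continuous.
  move=> t; apply: (@continuous_comp _ _ _ (fun t => g t - y) Num.norm).
    by apply: (@continuousB _ _ _ g (fun=> y)); [exact: cg0|exact: cst_continuous].
  exact: norm_continuous.
have clg y r : closed [set t | `|g t - y| <= r].
  exact: ((continuous_closedP _).1 (cg y) _ (@closed_le _ r)).
have gK y : g (\row_i inner y (w i)) = y.
  by rewrite [RHS](orthonormal_expand hY dimY y ow); apply: eq_bigr => i _; rewrite mxE.
pose K := [set t | `|g t - v x| <= rho]; pose C := rho + `|v x|.
have cK : compact K.
  apply: (@subclosed_compact _ _ [set t : 'rV[R]_m | forall i, t ord0 i \in `[- C, C]]).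
    exact: clg.
    by apply: (@rV_compact _ _ (fun=> `[- C, C]%classic)) => _; apply: segment_compact.
  move=> t Kt i; rewrite in_itv /= -ler_norml.
  have -> : t ord0 i = inner (g t) (w i).
    rewrite inner_suml // (bigD1 i) //= innerZl // ow // eqxx mulr1 big1 ?addr0 // => j ji.
    by rewrite innerZl // ow // (inj_eq val_inj) (negbTE ji) mulr0.
  apply: le_trans (abs_inner_le hY _ _) _.
  have -> : `|w i| = 1 by apply/eqP; rewrite -sqrp_eq1 // -innerxx // ow // eqxx.
  by rewrite mulr1 -[g t](subrK (v x)) (le_trans (ler_normD _ _)) // lerD2r.
pose F a := [set t | `|g t - u a| <= `|x - a|].
move: cK; rewrite compact_In0 => /(_ Z A (fun a => K `&` F a)) [].
- by exists F => // a _; exact: clg.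
- move=> D DA; pose s : seq Z := finmap.enum_fset D.
  have DA' i : A (tnth (in_tuple s) i) by exact/set_mem/DA/mem_tnth.
  have [|||y [yx yD]] := @finite_ball_inter _ (tnth (in_tuple s))
    (u \o tnth (in_tuple s)) _ _ Xx _ rho0.
  + by move=> i; exact: AX.
  + by move=> i j; exact: ul.
  + by move=> i; exact: uv.
  exists (\row_i inner y (w i)) => a /= aD; split; rewrite /K /F /= gK //.
  have /tnthP[i ->] : a \in in_tuple s by [].
  exact: yD.
- move=> t tF; exists (g t); split; first by have [] := tF _ Aa0.
  by move=> a /tF [].
Qed.

(** Zorn's lemma for partial extensions, encoded as a domain with a total function. The order sees
    only the values on the domains and is therefore a mere preorder. *)
Theorem contracts_property_E : (0 < m)%N -> property_E X v.
Proof.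
move=> m0 A rho u AX rho0 /lipschitz1P ul uv.
pose good (p : set Z * (Z -> Y)) := [/\ A `<=` p.1, p.1 `<=` X,
  forall a, A a -> p.2 a = u a,
  forall a b, p.1 a -> p.1 b -> `|p.2 a - p.2 b| <= `|a - b| &
  forall a, p.1 a -> `|p.2 a - v a| <= rho].
pose T := {p | good p}.
pose le (p q : T) := `[< (sval p).1 `<=` (sval q).1 /\
  forall a, (sval p).1 a -> (sval p).2 a = (sval q).2 a >].
have gAu : good (A, u) by split.
have [|||[[D f] gDf] tmax] := @ZL_preorder T (exist _ _ gAu) le.
- by move=> p; apply/asboolP; split.
- move=> q p r /asboolP [pq pqf] /asboolP [qr qrf]; apply/asboolP.
  by split=> [a /pq /qr //|a pa]; rewrite pqf // qrf //; exact: pq.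
- move=> S totS; have [[p0 Sp0]|nS] := pselect (exists p, S p); last first.
    by exists (exist _ _ gAu) => s Ss; case: nS; exists s.
  pose D := \bigcup_(p in S) (sval p).1.
  pose f z := if pselect (exists p : T, S p /\ (sval p).1 z) is left H
    then (sval (projT1 (cid H))).2 z else 0.
  have fE p z : S p -> (sval p).1 z -> f z = (sval p).2 z.
    move=> Sp pz; rewrite /f; case: pselect => [H|[]]; last by exists p.
    case: (cid H) => q [Sq qz] /=.
    by have [/asboolP [_ ->]|/asboolP [_ ->]] := totS _ _ Sp Sq.
  have common a b : D a -> D b -> exists p, [/\ S p, (sval p).1 a & (sval p).1 b].
    move=> [p Sp pa] [q Sq qb]; have [/asboolP [pq _]|/asboolP [qp _]] := totS _ _ Sp Sq.
      by exists q; split=> //; exact: pq.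
    by exists p; split=> //; exact: qp.
  have gDf : good (D, f).
    have [q1 q2 q3 q4 q5] := svalP p0; split=> /=.
    + by move=> a Aa; exists p0 => //; exact: q1.
    + by move=> a [p Sp]; have [_ pX _ _ _] := svalP p; exact: pX.
    + by move=> a Aa; rewrite (fE p0) //; [exact: q3|exact: q1].
    + move=> a b Da Db; have [p [Sp pa pb]] := common _ _ Da Db.
      by rewrite !(fE p) //; have [_ _ _ pl _] := svalP p; exact: pl.
    + move=> a [p Sp pa]; rewrite (fE p) //; have [_ _ _ _ pv] := svalP p; exact: pv.
  exists (exist _ _ gDf) => p Sp; apply/asboolP; split=> /= [a pa|a pa]; first by exists p.
  by rewrite (fE p).
have [/= AD DX fu fl fv] := gDf.
have DE : D = X.
  apply/seteqP; split=> // x Xx; apply: contrapT => Dx.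
  have [y [yx yD]] := one_point_extension m0 DX Xx rho0 fl fv.
  pose f' z := if z == x then y else f z.
  have f'E z : D z -> f' z = f z.
    by rewrite /f'; case: eqP => // -> /Dx.
  have f'x : f' x = y by rewrite /f' eqxx.
  have g' : good (D `|` [set x], f').
    split=> /=.
    + by move=> a /AD Da; left.
    + by move=> a [/DX //|->].
    + by move=> a Aa; rewrite f'E ?fu //; exact: AD.
    + move=> a b [Da|->] [Db|->]; rewrite ?f'x ?f'E //.
      * exact: fl.
      * by rewrite distrC [leRHS]distrC; exact: yD.
      * exact: yD.
      * by rewrite !subrr normr0.
    + by move=> a [Da|->]; rewrite ?f'x ?f'E //; exact: fv.
  have /tmax /asboolP [/= H _] : le (exist _ _ gDf) (exist _ _ g').
    by apply/asboolP; split=> /= a Da; [left|rewrite f'E].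
  by apply: Dx; apply: H; right.
exists f; split=> //.
- by apply/lipschitz1P; rewrite -DE.
- by rewrite -DE.
Qed.

End Extension.

(** * From property (E) to barycenters *)

Section Necessity.
Context (R : realType) (Z Y : completeNormedModType R) (n : nat) (X : set Z) (v : Z -> Y).
Hypotheses (hZ : is_hilbert Z) (hY : is_hilbert Y) (dimY : dim_eq Y n.+1).

(** As [|f| <= 1], the Gram matrix of the differences of the [x i] minus that of their
    [f]-components is positive, hence is the Gram matrix of vectors orthogonal to [e]. *)
Lemma isometric_embedding (x : 'I_n.+1 -> Z) (f : Z) (e : Y) :
  `|f| <= 1 -> `|e| = 1 ->
  exists W : 'I_n.+1 -> Y, (forall i j, `|W i - W j| = `|x i - x j|) /\
    forall i, inner (W i) e = inner f (x i - x ord0).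
Proof.
move=> f1 e1; have [on oo o0] := orthonormal_complete hY dimY e1 isT.
have ee : inner e e = 1 by rewrite innerxx // e1 expr1n.
(* There are [n] differences from the base point and [n] basis directions orthogonal to [e], just
   enough for the rows of [C]. *)
pose d i := x (lift ord0 i) - x ord0.
pose M i j := inner (d i) (d j) - inner f (d i) * inner f (d j).
have [||C HC] := @gram_factor R n M.
- by move=> i j; rewrite /M innerC [_ * inner f (d j)]mulrC.
- move=> u; pose S := \sum_i u i *: d i.
  have -> : \sum_i \sum_j u i * u j * M i j = `|S| ^+ 2 - inner f S ^+ 2.
    rewrite -innerxx expr2 {1}/S inner_suml // {2}/S inner_sumr // mulr_suml -sumrB.
    apply: eq_bigr => i _; rewrite {1}/S inner_sumr // mulr_sumr -sumrB.
    by apply: eq_bigr => j _; rewrite /M !innerZl // !innerZr //; ring.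
  rewrite subr_ge0 -real_normK ?num_real // ler_sqr ?nnegrE //.
  by apply: le_trans (abs_inner_le hZ _ _) _; rewrite ler_piMl.
pose G i := inner f (d i) *: e + \sum_(k < n) C i k *: on k.+1.
have eo k : (k < n)%N -> inner e (on k.+1) = 0 by move=> kn; rewrite -o0 oo.
have oe k : (k < n)%N -> inner (on k.+1) e = 0 by move=> kn; rewrite innerC eo.
have Ge i : inner (G i) e = inner f (d i).
  rewrite /G innerDl // innerZl // ee mulr1 inner_suml // big1 ?addr0 // => k _.
  by rewrite innerZl // oe // mulr0.
have Go i (k : 'I_n) : inner (G i) (on k.+1) = C i k.
  rewrite /G innerDl // innerZl // eo // mulr0 add0r inner_suml // (bigD1 k) //=.
  have okk : inner (on k.+1) (on k.+1) = 1 by rewrite oo ?ltnS ?eqxx.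
  rewrite innerZl // okk mulr1 big1 ?addr0 // => j jk.
  rewrite innerZl //.
  rewrite (oo j.+1 k.+1 (ltn_ord j) (ltn_ord k)).
  by rewrite eqSS (inj_eq val_inj) (negbTE jk) mulr0.
have GG i j : inner (G i) (G j) = inner (d i) (d j).
  rewrite {2}/G innerDr // innerZr // Ge inner_sumr //.
  under eq_bigr do rewrite innerZr // Go mulrC.
  by rewrite -HC /M mulrC addrC subrK.
pose W i := if unlift ord0 i is Some j then G j else 0.
have WE i j : inner (W i) (W j) = inner (x i - x ord0) (x j - x ord0).
  rewrite /W; case: unliftP => [i'|] ->; case: unliftP => [j'|] ->; first exact: GG.
  - by rewrite subrr (inner0r hY) (inner0r hZ).
  - by rewrite subrr (inner0l hY) (inner0l hZ).
  - by rewrite subrr (inner0l hY) (inner0l hZ).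
exists W; split=> [i j|i].
  apply/eqP; rewrite -(eqrXn2 (n := 2)) // normB_sqr // -!innerxx // !WE.
  have -> : x i - x j = (x i - x ord0) - (x j - x ord0) by rewrite opprB addrA subrK.
  by rewrite [X in _ == X]innerxx normB_sqr // -!innerxx.
rewrite /W; case: unliftP => [i'|] ->; first exact: Ge.
by rewrite subrr inner0l // inner0r.
Qed.

Theorem property_E_contracts : property_E X v -> contracts_barycenters X v n.+1.
Proof.
move=> EX; apply: contracts_barycenters_reindex => x t z Xz Xx wt.
rewrite leNgt; apply/negP => gt.
set g := `|v z - _| in gt; set N := `|z - _| in gt.
have g0 : 0 < g by exact: le_lt_trans (normr_ge0 _) gt.
pose e := g^-1 *: (v z - \sum_i t i *: v (x i)).
have e1 : `|e| = 1 by rewrite normrZ normfV normr_id mulVf // gt_eqF.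
pose h i := inner (v (x i)) e; pose h0 := inner (v z) e.
have hg : h0 - \sum_i t i * h i = g.
  have -> : \sum_i t i * h i = inner (\sum_i t i *: v (x i)) e.
    by rewrite inner_suml //; apply: eq_bigr => i _; rewrite innerZl.
  by rewrite -innerBl // innerZr // innerxx // -/g expr2 mulKf // gt_eqF.
(* Half the gap of the squares: positive, and small enough for [r t < g] below. *)
pose eps := (g ^+ 2 - N ^+ 2) / 2.
have gN : N ^+ 2 < g ^+ 2 by rewrite ltr_sqr // nnegrE normr_ge0.
have eps0 : 0 < eps by rewrite divr_gt0 // subr_gt0.
pose c i := x i - z.
have cE s : is_weights s -> \sum_i s i *: c i = \sum_i s i *: x i - z.
  move=> [_ s1]; rewrite /c; under eq_bigr do rewrite scalerBr.
  by rewrite sumrB -scaler_suml s1 scale1r.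
pose r (s : 'I_n.+1 -> R) := Num.sqrt (`|\sum_i s i *: c i| ^+ 2 + eps).
have r2 s : r s ^+ 2 = `|\sum_i s i *: c i| ^+ 2 + eps.
  by rewrite sqr_sqrtr // addr_ge0 ?sqr_ge0 // ltW.
(* Maximising [psi] picks the barycenter at which (C) fails most; the smoothing [eps]
   keeps [r] positive, and [- b / K] is then the gradient of [- r] at the maximiser. *)
pose psi (s : 'I_n.+1 -> R) := - \sum_i s i * h i - r s.
have cpsi : continuous (fun s : 'rV[R]_n.+1 => psi (s ord0)).
  have c1 : continuous (fun t : 'rV[R]_n.+1 => \sum_i t ord0 i * h i).
    apply: (@continuous_sum _ _ R^o _ _
      (fun i (t : 'rV[R]_n.+1) => t ord0 i *: (h i : R^o))) => i s.
    by apply: continuousZl; exact: coord_row_continuous.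
  have c2 : continuous (fun t : 'rV[R]_n.+1 => `|\sum_i t ord0 i *: c i|).
    move=> s; apply: continuous_comp; last exact: norm_continuous.
    apply: continuous_sum => i {}s; apply: continuousZl.
    exact: coord_row_continuous.
  have c3 : continuous (fun t : 'rV[R]_n.+1 => `|\sum_i t ord0 i *: c i| ^+ 2 + eps).
    by move=> s; exact: (continuousD (continuousM (c2 s) (c2 s)) (@cst_continuous _ _ eps s)).
  move=> s; apply: (@continuousB _ _ _ (fun t : 'rV[R]_n.+1 => - \sum_i t ord0 i * h i)
    (fun t => r (t ord0))).
    exact: (continuousN (c1 s)).
  by apply: continuous_comp; [exact: c3|exact: sqrt_continuous].
have [s ws smax] := simplex_max cpsi.
have [s0 s1] := ws.
pose K := r s; have K0 : 0 < K by rewrite sqrtr_gt0 ltr_wpDl ?sqr_ge0.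
pose b := \sum_i s i *: c i.
have bK : `|b| <= K by rewrite -ler_sqr ?nnegrE ?(ltW K0) // r2 lerDl ltW.
have psis : K < h0 - \sum_i s i * h i.
  have := smax _ wt; rewrite /psi -/K => H.
  have : r t < g.
    rewrite -ltr_sqr ?nnegrE ?sqrtr_ge0 ?(ltW g0) // r2 cE // distrC -/N /eps; lra.
  move: H hg; lra.
(* Since [2 * K * r s' <= r s' ^+ 2 + K ^+ 2], with equality at [s], this [s] also maximises a
   quadratic form, to which the optimality conditions apply. *)
have [|_ act] := @quadratic_simplex_max _ _ hZ _ (fun i => - (2 * K) * h i) c s ws.
  move=> s' ws'; have := smax _ ws'; rewrite /psi -/K.
  have sumE s'' : \sum_i s'' i * (- (2 * K) * h i) = - (2 * K) * \sum_i s'' i * h i.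
    by rewrite mulr_sumr; apply: eq_bigr => i _; ring.
  rewrite !sumE.
  have -> : `|\sum_i s' i *: c i| ^+ 2 = r s' ^+ 2 - eps by rewrite r2 addrK.
  have -> : `|\sum_i s i *: c i| ^+ 2 = K ^+ 2 - eps by rewrite r2 addrK.
  have := sqr_ge0 (r s' - K); nra.
rewrite -/b in act; set C := _ - _ in act.
pose f := - K^-1 *: b.
have f1 : `|f| <= 1 by rewrite normrZ normrN normfV (gtr0_norm K0) ler_pdivrMl // mulr1.
have [W [Wiso We]] := isometric_embedding x f1 e1.
(* On the points of positive weight [h] agrees with an affine function of slope [f], whose value at
   [x ord0] is [kappa]. *)
pose kappa := inner f (x ord0 - z) - C / (2 * K).
have hact j : 0 < s j -> h j = inner f (x j - x ord0) + kappa.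
  move=> /act H; rewrite /kappa addrA -innerDr // addrA subrK -/(c j) /f innerZl //.
  by rewrite -H; field; rewrite gt_eqF.
have ee : inner e e = 1 by rewrite innerxx // e1 expr1n.
(* Half the margin by which [h0] exceeds the mean of the [h i] plus [|b|]; the other half produces
   the final contradiction. *)
pose eta := (h0 - \sum_i s i * h i - `|b|) / 2.
have eta0 : 0 < eta by rewrite divr_gt0 // subr_gt0 (le_lt_trans bK).
pose p i := W i + (kappa + eta) *: e.
have pp i j : `|p i - p j| = `|x i - x j| by rewrite -Wiso /p opprD addrACA subrr addr0.
have pe i : 0 < s i -> inner (p i) e = h i + eta.
  by move=> si; rewrite /p innerDl // We innerZl // ee hact //; ring.
(* For large [rho] the ball of radius [rho] about [v (x i) + rho e] is nearly a
   half-space, so it contains the point [p i], lying strictly inside this half-space. *)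
pose rho := 1 + \sum_i `|p i - v (x i)| ^+ 2 / (2 * eta).
have term0 i : 0 <= `|p i - v (x i)| ^+ 2 / (2 * eta).
  by rewrite divr_ge0 ?sqr_ge0 // mulr_ge0 // ltW.
have rho1 : 1 <= rho by rewrite lerDl sumr_ge0.
have rho0 : 0 < rho by exact: lt_le_trans rho1.
have rhoi i : `|p i - v (x i)| ^+ 2 <= 2 * eta * rho.
  have : `|p i - v (x i)| ^+ 2 / (2 * eta) <= rho.
    by rewrite /rho (bigD1 i) //= addrCA lerDl addr_ge0 // sumr_ge0.
  have e2 : 0 < 2 * eta by rewrite mulr_gt0.
  by move=> H; rewrite mulrC -ler_pdivrMr.
pose A := [set y | exists i, 0 < s i /\ x i = y].
(* The index chosen for a point does not matter: [p] preserves distances, so [x i = x j] forces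
   [p i = p j]. *)
pose u y := if pselect (A y) is left H then p (projT1 (cid H)) - rho *: e else 0.
have uE i : 0 < s i -> u (x i) = p i - rho *: e.
  move=> si; rewrite /u; case: pselect => [H|[]]; last by exists i.
  case: (cid H) => j [_ ji] /=; congr (_ - _); apply/eqP.
  by rewrite -subr_eq0 -normr_eq0 pp ji subrr normr0.
have sqB (q : Y) : `|q - rho *: e| ^+ 2 = `|q| ^+ 2 - 2 * rho * inner q e + rho ^+ 2.
  by rewrite normB_sqr // innerZr // normrZ e1 mulr1 gtr0_norm //; ring.
have [||||ut [/lipschitz1P utl utu utv]] := EX A rho u.
- by move=> _ [i [_ <-]].
- exact: ltW.
- apply/lipschitz1P => _ _ [i [si <-]] [j [sj <-]].
  by rewrite !uE // opprB addrA subrK pp.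
- move=> _ [i [si <-]]; rewrite uE // addrAC -ler_sqr ?nnegrE ?(ltW rho0) // sqB.
  rewrite innerBl // pe // -/(h i) (addrC (h i)) addrK.
  by have := rhoi i; lra.
(* [q] undoes the translation. In direction [e] it is not below [v z], by [rho]-closeness, and it
   stays within [|z - x i|] of each [p i] of positive weight. *)
pose q := ut z + rho *: e.
have qv : 0 <= inner (q - v z) e.
  have := utv _ Xz; rewrite -ler_sqr ?nnegrE ?(ltW rho0) //.
  have -> : ut z - v z = q - v z - rho *: e by rewrite /q addrAC addrK.
  rewrite sqB => H; have : 0 <= 2 * rho * inner (q - v z) e.
    by have := sqr_ge0 (`|q - v z|); move: H; lra.
  by rewrite pmulr_rge0 // mulr_gt0.
have qp i : 0 < s i -> `|q - p i| <= `|z - x i|.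
  move=> si; have -> : q - p i = ut z - ut (x i).
    by rewrite (utu (x i)) ?uE //; [rewrite /q opprB addrA|exists i].
  exact: utl.
(* The variances agree, so only the biases differ: [q] is within [|b|] of the barycenter [pb]. *)
have := variance_identity hY p q s1; have := variance_identity hZ x z s1.
set pb := \sum_i s i *: p i; rewrite (distrC z (\sum_i s i *: x i)) -cE // -/b.
have -> : \sum_i \sum_j s i * s j * `|p i - p j| ^+ 2 =
    \sum_i \sum_j s i * s j * `|x i - x j| ^+ 2.
  by apply: eq_bigr => i _; apply: eq_bigr => j _; rewrite pp.
move=> Hx Hp.
have qpb : `|q - pb| <= `|b|.
  rewrite -ler_sqr ?nnegrE //.
  have : \sum_i s i * `|q - p i| ^+ 2 <= \sum_i s i * `|z - x i| ^+ 2.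
    apply: ler_sum => i _; have := s0 i; rewrite le_eqVlt => /orP[/eqP <-|si].
      by rewrite !mul0r.
    by rewrite ler_pM2l // ler_sqr ?nnegrE // qp.
  by rewrite Hx Hp lerD2r.
have pbe : inner pb e = \sum_i s i * h i + eta.
  rewrite inner_suml // -[eta in RHS]mul1r -s1 mulr_suml -big_split /=.
  apply: eq_bigr => i _; rewrite innerZl //.
  have := s0 i; rewrite le_eqVlt => /orP[/eqP <-|si]; first by rewrite !mul0r addr0.
  by rewrite pe // mulrDr.
have : inner (q - pb) e <= `|b|.
  by apply: le_trans (inner_le_norm hY _ _) _; rewrite e1 mulr1.
move: qv; rewrite !innerBl // pbe -/h0 => Hq1 Hq2.
have Eeta : 2 * eta = h0 - \sum_i s i * h i - `|b| by rewrite /eta mulrC divfK.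
by move: eta0; lra.
Qed.

End Necessity.

(** * Borel sets of separable metric spaces *)

(* Without this, completeness of products would not yield the structures joining it
   with the pointed and pseudometric ones. *)
HB.saturate prod.

Section ProductComplete.
Context (R : realType) (U V : completePseudoMetricType R).

(** Both projections of a Cauchy filter are Cauchy. Completeness of products is needed to pair
    standard Borel spaces. *)
Lemma cauchy_cvg_prod (F : set_system (U * V)) : ProperFilter F -> cauchy F -> cvg F.
Proof.
move=> FF /cauchy_ballP cF.
have c1 : cauchy_ball (fst @ F).
  move=> e e0; have [[A B] /= [FA FB] AB] := cF e e0.
  exists (fst @` A, fst @` B) => /=.
    split; [apply: filterS FA|apply: filterS FB] => x ?; by exists x.
  move=> [_ _] /= [[a Aa <-] [b Bb <-]].
  by have [] := AB (a, b) (conj Aa Bb).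
have c2 : cauchy_ball (snd @ F).
  move=> e e0; have [[A B] /= [FA FB] AB] := cF e e0.
  exists (snd @` A, snd @` B) => /=.
    split; [apply: filterS FA|apply: filterS FB] => x ?; by exists x.
  move=> [_ _] /= [[a Aa <-] [b Bb <-]].
  by have [] := AB (a, b) (conj Aa Bb).
have := (cauchy_cvgP (fst @ F)).1 ((cauchy_ballP _).1 c1).
rewrite cvg_ex => -[l1 /fcvg_ballP F1].
have := (cauchy_cvgP (snd @ F)).1 ((cauchy_ballP _).1 c2).
rewrite cvg_ex => -[l2 /fcvg_ballP F2].
rewrite cvg_ex; exists (l1, l2); apply/fcvg_ballP => e e0.
have H1 : F [set x | ball l1 e x.1] by exact: F1.
have H2 : F [set x | ball l2 e x.2] by exact: F2.
by apply: filterS (filterI H1 H2) => -[a b] [].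
Qed.

HB.instance Definition _ := Uniform_isComplete.Build (U * V)%type cauchy_cvg_prod.

End ProductComplete.

Section Borel.
Context (R : realType).

Lemma open_borel (T : ptopologicalType) (A : set T) :
  open A -> measurable (A : set (borel T)).
Proof. exact: sub_sigma_algebra. Qed.

Lemma closed_borel (T : ptopologicalType) (A : set T) :
  closed A -> measurable (A : set (borel T)).
Proof.
by move=> cA; rewrite -(setCK A); apply: measurableC; apply: open_borel; apply: closed_openC.
Qed.

Lemma borel_set1 (T : completeNormedModType R) (y : T) :
  measurable ([set y] : set (borel T)).
Proof.
apply: closed_borel.
exact: accessible_closed_set1 (hausdorff_accessible (@norm_hausdorff _ T)) y.
Qed.

Lemma measurable_fun_borel d (E : measurableType d) (T : ptopologicalType)
    (f : E -> borel T) :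
  (forall A : set T, open A -> measurable (f @^-1` A)) -> measurable_fun setT f.
Proof.
move=> mf; apply: (@measurability _ _ E (borel T) setT f (@open T) erefl) => _ [A oA <-].
by rewrite setTI; exact: mf.
Qed.

Lemma measurable_fun_opens d (E : measurableType d) (f : E -> R) :
  (forall A : set R, open A -> measurable (f @^-1` A)) -> measurable_fun setT f.
Proof.
move=> mf; apply: (measurability _ (measurable_realfun.RGenOInfty.measurableE R)).
by move=> _ [_ [x ->] <-]; rewrite setTI; apply: mf; exact: interval_open.
Qed.

Lemma continuous_borel (T T' : ptopologicalType) (f : T -> T') : continuous f ->
  measurable_fun setT (f : borel T -> borel T').
Proof.
move=> /continuousP cf; apply: measurable_fun_borel => A oA.
by apply: open_borel; exact: cf.
Qed.

Lemma continuous_borel_real (T : ptopologicalType) (f : T -> R) : continuous f ->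
  measurable_fun setT (f : borel T -> R).
Proof.
move=> /continuousP cf; apply: measurable_fun_opens => A oA.
by apply: open_borel; exact: cf.
Qed.

Lemma separable_sequence (T : pseudoPMetricType R) : separable T ->
  exists u : nat -> T, forall x e, 0 < e -> exists n, ball x e (u n).
Proof.
move=> [D /pfcard_geP [->|[u]] dD].
  have [x []] : [set: T] `&` set0 !=set0 by apply: dD; [exists (point : T)|exact: openT].
  by [].
exists u => x e e0.
have [y [/interior_subset yx Dy]] : (ball x e)° `&` D !=set0.
  by apply: dD; [exists x; exact: nbhsx_ballx|exact: open_interior].
have [n _ ny] : (u @` setT) y by exact: surj.
by exists n; rewrite ny.
Qed.

(** By separability an open set is a countable union of small rectangles centred on dense sequences,
    so it lies in the product of the Borel sigma-algebras. *)
Lemma open_borel_prod (T1 T2 : completePseudoMetricType R) (A : set (T1 * T2)) :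
  separable T1 -> separable T2 -> open A ->
  measurable (A : set (borel T1 * borel T2)).
Proof.
move=> /separable_sequence [u du] /separable_sequence [w dw] oA.
pose r (k : nat) : R := k.+1%:R^-1.
(* Balls of a pseudometric structure need not be open, hence the interiors. *)
pose B i j k : set (borel T1 * borel T2) := (ball (u i) (r k))° `*` (ball (w j) (r k))°.
have -> : A = \bigcup_i \bigcup_j \bigcup_(k in [set k | B i j k `<=` A]) B i j k.
  apply/seteqP; split=> [[x y] Axy|]; last by move=> [x y] [i _ [j _ [k]]] /= h; exact: h.
  have /nbhs_ballP [e /= e0 eA] : nbhs (x, y) A by exact: open_nbhs_nbhs.
  have [k kP] : exists k, 2 * r k < e.
    have [k _ /(_ k (leqnn k))] := near_infty_natSinv_lt (PosNum (divr_gt0 e0 (ltr0n R 2))).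
    by rewrite /= ltr_pdivlMr // mulrC => ?; exists k.
  have r0 : 0 < r k by rewrite invr_gt0 ltr0n.
  have r20 : 0 < r k / 2 by rewrite divr_gt0.
  have [i xi] := du x _ r20; have [j yj] := dw y _ r20.
  exists i => //; exists j => //; exists k; last first.
    split; apply/nbhs_ballP; exists (r k / 2) => //= z xz.
      by rewrite (splitr (r k)); apply: ball_triangle xz; apply: ball_sym.
    by rewrite (splitr (r k)); apply: ball_triangle xz; apply: ball_sym.
  move=> [x' y'] [/= /interior_subset x'i /interior_subset y'j]; apply: eA.
  have le : r k / 2 + r k <= e by move: kP r0; lra.
  split; apply: (le_ball le).
    exact: ball_triangle xi x'i.
  exact: ball_triangle yj y'j.
apply: bigcup_measurable => i _; apply: bigcup_measurable => j _.
apply: bigcup_measurable => k _; apply: measurableX; apply: open_borel; exact: open_interior.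
Qed.

Lemma continuous_borel_prod (T1 T2 : completePseudoMetricType R) (T' : ptopologicalType)
    (f : T1 * T2 -> T') : separable T1 -> separable T2 -> continuous f ->
  measurable_fun setT (f : borel T1 * borel T2 -> borel T').
Proof.
move=> s1 s2 /continuousP cf; apply: measurable_fun_borel => A oA.
by apply: open_borel_prod => //; exact: cf.
Qed.

Lemma continuous_borel_prod_real (T1 T2 : completePseudoMetricType R)
    (f : T1 * T2 -> R) : separable T1 -> separable T2 -> continuous f ->
  measurable_fun setT (f : borel T1 * borel T2 -> R).
Proof.
move=> s1 s2 /continuousP cf; apply: measurable_fun_opens => A oA.
by apply: open_borel_prod => //; exact: cf.
Qed.

Lemma separable_prod (T1 T2 : completePseudoMetricType R) :
  separable T1 -> separable T2 -> separable (T1 * T2)%type.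
Proof.
move=> [D1 cD1 dD1] [D2 cD2 dD2]; exists (D1 `*` D2); first exact: countableX.
move=> O [[x y] Oxy] oO.
have /nbhs_ballP [e /= e0 eO] : nbhs (x, y) O by exact: open_nbhs_nbhs.
have [a [/interior_subset xa Da]] : (ball x e)° `&` D1 !=set0.
  by apply: dD1; [exists x; exact: nbhsx_ballx|exact: open_interior].
have [b [/interior_subset yb Db]] : (ball y e)° `&` D2 !=set0.
  by apply: dD2; [exists y; exact: nbhsx_ballx|exact: open_interior].
by exists (a, b); split=> //; exact: eO.
Qed.

Lemma hausdorff_prod (T1 T2 : completePseudoMetricType R) :
  hausdorff_space T1 -> hausdorff_space T2 -> hausdorff_space (T1 * T2)%type.
Proof.
move=> h1 h2 [x1 x2] [y1 y2] cl.
congr pair; [apply: h1|apply: h2] => A B xA yB.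
  have nA : nbhs (x1, x2) (fst @^-1` A) by exact: (@cvg_fst _ _ (nbhs x1) (nbhs x2)).
  have nB : nbhs (y1, y2) (fst @^-1` B) by exact: (@cvg_fst _ _ (nbhs y1) (nbhs y2)).
  by have [z [zA zB]] := cl _ _ nA nB; exists z.1.
have nA : nbhs (x1, x2) (snd @^-1` A) by exact: (@cvg_snd _ _ (nbhs x1) (nbhs x2)).
have nB : nbhs (y1, y2) (snd @^-1` B) by exact: (@cvg_snd _ _ (nbhs y1) (nbhs y2)).
by have [z [zA zB]] := cl _ _ nA nB; exists z.2.
Qed.

Lemma standard_borel_borel (W : completePseudoMetricType R) :
  hausdorff_space W -> separable W -> standard_borel R (borel W).
Proof.
move=> hW sW; exists W, (@idfun (borel W)), (@idfun (borel W)).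
by split; [split => //; exact: measurable_id|].
Qed.

(** For the coupling [(v S, v T, (S, U))], whose auxiliary variable takes values in a product. *)
Lemma standard_borel_prod d1 d2 (E1 : measurableType d1) (E2 : measurableType d2) :
  standard_borel R E1 -> standard_borel R E2 -> standard_borel R (E1 * E2)%type.
Proof.
move=> [W1 [f1 [g1 [[h1 s1 mf1 mg1] [fg1 gf1]]]]].
move=> [W2 [f2 [g2 [[h2 s2 mf2 mg2] [fg2 gf2]]]]].
exists (W1 * W2)%type.
exists (fun x : E1 * E2 => (f1 x.1, f2 x.2) : borel (W1 * W2)%type).
exists (fun w : borel (W1 * W2)%type => (g1 w.1, g2 w.2)).
split; last by split=> [[a b]|[a b]] /=; rewrite ?fg1 ?fg2 ?gf1 ?gf2.
split.
- exact: hausdorff_prod.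
- exact: separable_prod.
- have mid := @continuous_borel_prod W1 W2 _ idfun s1 s2 (fun x => cvg_id).
  apply: (measurableT_comp mid); apply: measurable_fun_pair.
    exact: (measurableT_comp mf1 measurable_fst).
  exact: (measurableT_comp mf2 measurable_snd).
- apply: measurable_fun_pair.
    apply: (measurableT_comp mg1); apply: (@continuous_borel (W1 * W2)%type W1 fst).
    by move=> x; exact: cvg_fst.
  apply: (measurableT_comp mg2); apply: (@continuous_borel (W1 * W2)%type W2 snd).
  by move=> x; exact: cvg_snd.
Qed.

End Borel.

Section BorelHilbert.
Context (R : realType) (H : completeNormedModType R) (sH : separable H).
Context d (Omega : measurableType d).
Implicit Types f g : Omega -> borel H.

Lemma measurable_borel_add f g : measurable_fun setT f -> measurable_fun setT g ->
  measurable_fun setT (fun w => (f w : H) + g w : borel H).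
Proof.
move=> mf mg.
have cD : continuous (fun x : H * H => x.1 + x.2) by exact: add_continuous.
exact: (measurableT_comp (@continuous_borel_prod R H H H _ sH sH cD) (measurable_fun_pair mf mg)).
Qed.

Lemma measurable_dist f g : measurable_fun setT f -> measurable_fun setT g ->
  measurable_fun setT (fun w => `|(f w : H) - g w|).
Proof.
move=> mf mg.
have cD : continuous (fun x : H * H => `|x.1 - x.2|).
  move=> x; apply: (@continuous_comp _ _ _ (fun x : H * H => x.1 - x.2) Num.norm).
    exact: sub_continuous.
  exact: norm_continuous.
exact: (measurableT_comp (@continuous_borel_prod_real R H H _ sH sH cD) (measurable_fun_pair mf mg)).
Qed.

Lemma measurable_borel_norm f : measurable_fun setT f ->
  measurable_fun setT (fun w => `|f w : H|).
Proof.
by move=> mf; exact: (measurableT_comp (continuous_borel_real (@norm_continuous _ H)) mf).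
Qed.

Lemma measurable_inner f z : measurable_fun setT f ->
  measurable_fun setT (fun w => inner (f w : H) z).
Proof.
by move=> mf; exact: (measurableT_comp (continuous_borel_real (@inner_continuous _ H z)) mf).
Qed.

End BorelHilbert.

(** * Bochner integrals *)

Definition mfun_of d1 d2 (T1 : measurableType d1) (T2 : measurableType d2)
    (f : T1 -> T2) (mf : measurable_fun setT f) : {mfun T1 >-> T2} :=
  HB.pack f (isMeasurableFun.Build _ _ _ _ f mf).

Section BochnerTheory.
Context (R : realType) (H : completeNormedModType R) (hH : is_hilbert H) (sH : separable H).
Context d (Omega : measurableType d) (P : probability Omega R).
Implicit Types (f s : Omega -> borel H) (D : set Omega).

(** [s n w] is a point nearest to [f w] among 0 and the first [n] terms of a dense sequence;
    starting from 0 yields the domination by [|f w|]. *)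
Lemma simple_approximation f : measurable_fun setT f ->
  exists s : nat -> Omega -> borel H,
    [/\ forall n, measurable_fun setT (s n), forall n, finite_set (range (s n)),
        forall n w, `|(f w : H) - s n w| <= `|f w : H| &
        forall w, `|(f w : H) - s n w| @[n --> \oo] --> (0 : R)].
Proof.
move=> mf; have [u du] := separable_sequence sH.
pose fix s n : Omega -> borel H := if n is n'.+1
  then fun w => if `|(f w : H) - u n'| < `|(f w : H) - s n' w| then u n' else s n' w
  else cst (0 : H).
have ms n : measurable_fun setT (s n).
  elim: n => [|n IH]; first exact: measurable_cst.
  apply: measurable_fun_ifT => //.
  apply: measurable_realfun.measurable_fun_ltr.
    by apply: measurable_dist => //; exact: measurable_cst.
  exact: measurable_dist.
have sS n w : `|(f w : H) - s n.+1 w| <= `|(f w : H) - s n w|.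
  by rewrite /=; case: ifPn => // /ltW.
have su n w : `|(f w : H) - s n.+1 w| <= `|(f w : H) - u n|.
  by rewrite /=; case: ifPn => //; rewrite -leNgt.
have smono n k w : (n <= k)%N -> `|(f w : H) - s k w| <= `|(f w : H) - s n w|.
  elim: k => [|k IH]; first by rewrite leqn0 => /eqP ->.
  rewrite leq_eqVlt => /orP[/eqP -> //|]; rewrite ltnS => /IH; exact: le_trans.
exists s; split=> //.
- elim=> [|n IH].
    by apply: (@sub_finite_set _ _ [set (0 : H)]) => // _ [w _ <-].
  apply: (@sub_finite_set _ _ (range (s n) `|` [set u n])).
    by move=> _ [w _ <-] /=; case: ifP => _; [right|left; exists w].
  by rewrite finite_setU.
- by move=> n w; have := smono 0%N n w (leq0n _); rewrite /= subr0.
- move=> w; apply/cvgrPdist_lt => e e0; have [n fn] := du (f w) e e0.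
  exists n.+1 => // k /= nk; rewrite sub0r normrN normr_id.
  apply: le_lt_trans (smono _ _ _ nk) _; apply: le_lt_trans (su _ _) _.
  by move: fn; rewrite -ball_normE.
Qed.

Lemma finite_range_bounded s : finite_set (range s) ->
  exists C, forall w, `|s w : H| <= C.
Proof.
move=> /finite_seqP [r rE]; exists (\sum_(y <- r) `|y : H|) => w.
have : s w \in r by have : range s (s w) by [exists w]; rewrite rE.
elim: r {rE} => // y r IH; rewrite inE big_cons => /orP[/eqP ->|/IH].
  by rewrite lerDl; apply: sumr_ge0.
by move=> h; rewrite (le_trans h) // lerDr.
Qed.

Lemma bounded_integrable D (g : Omega -> R) C : measurable D ->
  measurable_fun setT g -> (forall w, `|g w| <= C) -> P.-integrable D (EFin \o g).
Proof.
move=> mD mg gC; apply: measurable_bounded_integrable => //.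
- by rewrite (le_lt_trans (probability_le1 P mD)) // ltry.
- exact: measurable_funS mg.
- exists C; split; first by rewrite num_real.
  by move=> M CM w _ /=; rewrite (le_trans (gC w)) // ltW.
Qed.

Lemma integrable_le D (g : Omega -> R) (k : Omega -> R) : measurable D ->
  measurable_fun setT g -> (forall w, `|g w| <= k w) ->
  P.-integrable D (EFin \o k) -> P.-integrable D (EFin \o g).
Proof.
move=> mD mg gk; apply: le_integrable => //.
  by apply/measurable_realfun.measurable_EFinP; exact: measurable_funS mg.
by move=> w _ /=; rewrite lee_fin (le_trans (gk w)) // ler_norm.
Qed.

Lemma integrable_sumr D (g k : Omega -> R) : measurable D ->
  P.-integrable D (EFin \o g) -> P.-integrable D (EFin \o k) ->
  P.-integrable D (EFin \o (fun w => g w + k w)).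
Proof. by move=> mD ig ik; exact: (integrableD mD ig ik). Qed.

Lemma integrable_subr D (g k : Omega -> R) : measurable D ->
  P.-integrable D (EFin \o g) -> P.-integrable D (EFin \o k) ->
  P.-integrable D (EFin \o (fun w => g w - k w)).
Proof. by move=> mD ig ik; exact: (integrableB mD ig ik). Qed.

Lemma integrable_mulr D (a : R) (g : Omega -> R) : measurable D ->
  P.-integrable D (EFin \o g) -> P.-integrable D (EFin \o (fun w => a * g w)).
Proof. by move=> mD ig; exact: (integrableZl mD a ig). Qed.

Lemma integrable_inner D f z : measurable D -> measurable_fun setT f ->
  P.-integrable D (EFin \o (fun w => `|f w : H|)) ->
  P.-integrable D (EFin \o (fun w => inner (f w : H) z)).
Proof.
move=> mD mf fi.
apply: (@integrable_le _ _ (fun w => `|z| * `|f w : H|)) => //.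
- exact: measurable_inner.
- by move=> w; rewrite mulrC; exact: abs_inner_le.
- exact: integrable_mulr.
Qed.

(** Splitting [s] into indicators of its values reduces a vector integral, tested against [z], to
    Lebesgue integrals of real functions. *)
Lemma simple_integral_inner D s z : measurable D -> measurable_fun setT s ->
  finite_set (range s) ->
  inner (simple_integral P D s) z = \int[P]_(w in D) inner (s w : H) z.
Proof.
move=> mD ms /finite_seqP [r0 r0E]; pose r := undup r0.
have rE : range s = [set` r] by rewrite r0E; apply/seteqP; split=> y /=; rewrite mem_undup.
have ps y : measurable (s @^-1` [set y]).
  rewrite -[X in measurable X]setTI; apply: ms => //; exact: borel_set1.
have sw w : s w \in r.
  by have : range s (s w) by [exists w]; rewrite rE.
rewrite /simple_integral rE -fsbig_seq ?undup_uniq // inner_suml //.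
apply: EFin_inj; rewrite /Rintegral.
have -> : (\int[P]_(w in D) (inner (s w : H) z)%:E)%E =
    (\int[P]_(w in D) \sum_(y <- r) ((inner (y : H) z)%:E * (\1_(s @^-1` [set y]) w)%:E))%E.
  apply: eq_integral => w _.
  rewrite (bigD1_seq (s w)) //= ?undup_uniq //.
  rewrite indicE mem_set // mule1 big1 ?adde0 // => y ysw.
  by rewrite indicE memNset ?mule0 // => /= ye; rewrite ye eqxx in ysw.
have ii y : P.-integrable D (EFin \o \1_(s @^-1` [set y])).
  apply: (@bounded_integrable _ _ 1) => //.
  by move=> w; rewrite indicE; case: (_ \in _); rewrite ?normr1 ?normr0.
have fP y : P (s @^-1` [set y] `&` D) \is a fin_num.
  by rewrite fin_num_measure //; exact: measurableI.
have IE y : (\int[P]_(w in D) ((inner (y : H) z)%:E * (\1_(s @^-1` [set y]) w)%:E))%E =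
    (inner (fine (P (D `&` s @^-1` [set y])) *: (y : H)) z)%:E.
  transitivity ((inner (y : H) z)%:E * \int[P]_(w in D) (\1_(s @^-1` [set y]) w)%:E)%E.
    exact: (integralZl mD (ii y)).
  have -> : (\int[P]_(w in D) (\1_(s @^-1` [set y]) w)%:E)%E =
      (fine (P (D `&` s @^-1` [set y])))%:E.
    by rewrite [D `&` _]setIC [LHS]integral_indic //; apply/esym; exact: (fineK (fP y)).
  by rewrite -EFinM innerZl // mulrC.
rewrite integral_sum //; last by move=> y; exact: (integrableZl mD _ (ii y)).
by under [in RHS]eq_bigr do rewrite IE; rewrite sumEFin.
Qed.

Lemma simple_integral_close D f s z : measurable D -> measurable_fun setT f ->
  P.-integrable D (EFin \o (fun w => `|f w : H|)) ->
  measurable_fun setT s -> finite_set (range s) ->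
  `|inner (simple_integral P D s) z - \int[P]_(w in D) inner (f w : H) z| <=
  `|z| * \int[P]_(w in D) `|(f w : H) - s w|.
Proof.
move=> mD mf fi ms fs; have [C sC] := finite_range_bounded fs.
have si : P.-integrable D (EFin \o (fun w => `|s w : H|)).
  apply: (@bounded_integrable _ _ C) => //; first exact: measurable_borel_norm.
  by move=> w; rewrite normr_id.
have di : P.-integrable D (EFin \o (fun w => `|(f w : H) - s w|)).
  apply: (@integrable_le _ _ (fun w => `|f w : H| + `|s w : H|)) => //.
  - exact: measurable_dist.
  - by move=> w; rewrite normr_id ler_normB.
  - exact: integrable_sumr.
rewrite simple_integral_inner // -RintegralB //; try exact: integrable_inner.
have sfi : P.-integrable D (EFin \o (fun w => inner (s w : H) z - inner (f w : H) z)).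
  by apply: integrable_subr => //; exact: integrable_inner.
apply: le_trans (le_normr_Rintegral mD sfi) _.
rewrite -RintegralZl //; apply: le_Rintegral => //.
- exact: integrable_norm.
- exact: integrable_mulr.
- by move=> w _; rewrite -innerBl // distrC mulrC abs_inner_le.
Qed.

(** A Bochner integral is also a weak integral: the bound of [simple_integral_close] passes to the
    limit, and a single approximant at finite distance already gives integrability. *)
Lemma bochner_integral_inner D f x : measurable D -> measurable_fun setT f ->
  bochner_integral P D f x ->
  P.-integrable D (EFin \o (fun w => `|f w : H|)) /\
  forall z, inner x z = \int[P]_(w in D) inner (f w : H) z.
Proof.
move=> mD mf [_ [s [fs cs cx]]].
have ms n : measurable_fun setT (s n) by exact: measurable_funPT.
have si n : P.-integrable D (EFin \o (fun w => `|s n w : H|)).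
  have [C sC] := finite_range_bounded (fs n).
  apply: (@bounded_integrable _ _ C) => //; first exact: measurable_borel_norm.
  by move=> w; rewrite normr_id.
have fi : P.-integrable D (EFin \o (fun w => `|f w : H|)).
  have [n _ /(_ n (leqnn n)) fin] := cvg_is_fine cs.
  have di : P.-integrable D (EFin \o (fun w => `|(f w : H) - s n w|)).
    apply/integrableP; split.
      apply/measurable_realfun.measurable_EFinP.
      exact: measurable_funS (measurable_dist sH mf (ms n)).
    under eq_integral do rewrite /= normr_id.
    by rewrite ltey_eq fin.
  apply: (@integrable_le _ _ (fun w => `|(f w : H) - s n w| + `|s n w : H|)) => //.
  - exact: measurable_borel_norm.
  - by move=> w; rewrite normr_id -{1}[f w](subrK (s n w : H)) ler_normD.
  - exact: integrable_sumr.
split=> // z.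
have cz : inner (simple_integral P D (s n)) z @[n --> \oo] --> inner x z.
  exact: (@cvg_comp _ _ _ (fun n => simple_integral P D (s n)) (fun y : H => inner y z)
    _ _ _ cx (@inner_continuous _ _ z x)).
apply: (cvg_unique (@norm_hausdorff _ R^o) cz).
apply/cvgrPdist_le => /= e e0.
have e1 : 0 < e / (`|z| + 1) by rewrite divr_gt0 // ltr_wpDl.
have cf : \int[P]_(w in D) `|(f w : H) - s n w| @[n --> \oo] --> (0 : R).
  exact: (fine_cvg cs).
have [n _ Hn] := (cvgrPdist_le _ _).1 cf _ e1.
exists n => // k /= /Hn /=; rewrite sub0r normrN => close.
rewrite distrC; apply: le_trans (simple_integral_close _ mD mf fi (ms k) (fs k)) _.
apply: (@le_trans _ _ (`|z| * (e / (`|z| + 1)))).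
  by rewrite ler_wpM2l // (le_trans _ close) // ler_norm.
by rewrite mulrCA ger_pMr // ler_pdivrMr ?mul1r ?lerDl // ltr_wpDl.
Qed.

(** Dominated convergence makes the simple functions converge in L^1, so their integrals are Cauchy
    and completeness gives the limit. *)
Lemma bochner_integral_exists D f : measurable D -> measurable_fun setT f ->
  P.-integrable setT (EFin \o (fun w => `|f w : H|)) ->
  exists x, bochner_integral P D f x.
Proof.
move=> mD mf fiT.
have fi : P.-integrable D (EFin \o (fun w => `|f w : H|)) by exact: integrableS fiT.
have [s [ms fs sf sc]] := simple_approximation mf.
have cs : (\int[P]_(w in D) (`|(f w : H) - s n w|)%:E @[n --> \oo] --> 0)%E.
  have [||||_ _] := @dominated_convergence _ _ _ P D mD
    (fun n w => (`|(f w : H) - s n w|)%:E) (cst 0%E) (EFin \o (fun w => `|f w : H|)) _ _ _ fi.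
  - move=> n; apply/measurable_realfun.measurable_EFinP.
    exact: measurable_funS (measurable_dist sH mf (ms n)).
  - exact: measurable_cst.
  - by apply: aeW => w _; apply: cvg_EFin; [exact: nearW|exact: sc].
  - by apply: aeW => w n _; rewrite /= normr_id lee_fin sf.
  by rewrite integral0.
pose I n := \int[P]_(w in D) `|(f w : H) - s n w|.
have cI : I n @[n --> \oo] --> 0 by exact: (fine_cvg cs).
pose SI n := simple_integral P D (s n).
have close n k : `|SI n - SI k| <= I n + I k.
  (* The difference [a] serves as its own test vector. *)
  set a := SI n - SI k; have [->|a0] := eqVneq a 0.
    by rewrite normr0 addr_ge0 // Rintegral_ge0.
  rewrite -(ler_pM2l (x := `|a|)) ?normr_gt0 // -expr2 -innerxx {1}/a innerBl //.
  have := simple_integral_close a mD mf fi (ms n) (fs n).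
  have := simple_integral_close a mD mf fi (ms k) (fs k).
  rewrite -/(SI n) -/(SI k) -/(I n) -/(I k) !ler_norml mulrDr.
  by move=> /andP[h1 _] /andP[_ h2]; lra.
have [x cx] : exists x : H, SI n @[n --> \oo] --> x.
  have : cvg (SI n @[n --> \oo]).
    apply/cauchy_cvgP; apply: cauchy_exP => e e0.
    have e2 : 0 < e / 2 by rewrite divr_gt0.
    have [N _ HN] := (cvgrPdist_lt _ _).1 cI _ e2.
    exists (SI N); exists N => // n /= Nn; rewrite -ball_normE /=.
    apply: le_lt_trans (close _ _) _; rewrite [ltRHS](splitr e).
    have := HN N (leqnn N); have := HN n Nn; rewrite /= !sub0r !normrN => h1 h2.
    by apply: ltrD; apply: le_lt_trans (ler_norm _) _.
  by move=> h; exists (lim (SI n @[n --> \oo])).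
exists x; split; first exact: measurable_funS mf.
by exists (fun n => mfun_of (ms n)); split.
Qed.

Lemma bochner_integral_eq D f g x y : measurable D ->
  measurable_fun setT f -> measurable_fun setT g ->
  bochner_integral P D f x -> bochner_integral P D g y ->
  (forall z, \int[P]_(w in D) inner (f w : H) z = \int[P]_(w in D) inner (g w : H) z) ->
  x = y.
Proof.
move=> mD mf mg fx gy fg; apply: (inner_inj hH) => z.
have [_ ->] := bochner_integral_inner mD mf fx.
by have [_ ->] := bochner_integral_inner mD mg gy.
Qed.

End BochnerTheory.

(** * Kernels and disintegration *)

Lemma ge0_integral_mrestr (R : realType) d (T : measurableType d)
    (mu : {measure set T -> \bar R}) (D : set T) (mD : measurable D) (f : T -> \bar R) :
  (forall x, (0 <= f x)%E) -> measurable_fun setT f ->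
  (\int[mrestr mu mD]_x f x = \int[mu]_(x in D) f x)%E.
Proof.
move=> f0 mf; rewrite (@ge0_negligible_integral _ _ _ _ setT (~` D)) //; last 2 first.
- exact: measurableC.
- by rewrite /= /mrestr setICl measure0.
rewrite setTD setCK; apply: eq_measure_integral => A mA AD.
by rewrite /= /mrestr setIidl.
Qed.

Section ConstKernel.
Context d d' (X : measurableType d) (E : measurableType d') (R : realType).
Variable mu : {measure set E -> \bar R}.

(* The proof [mu1] is an argument so that the instances below can be declared. *)
Definition const_kernel (mu1 : (mu setT <= 1)%E) : X -> {measure set E -> \bar R} :=
  fun=> mu.

Hypothesis mu1 : (mu setT <= 1)%E.

Let measurable_const_kernel U : measurable U ->
  measurable_fun [set: X] (const_kernel mu1 ^~ U).
Proof. by move=> _; exact: measurable_cst. Qed.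

HB.instance Definition _ := isKernel.Build _ _ _ _ _ (const_kernel mu1)
  measurable_const_kernel.

Let const_kernel_le1 : (ereal_sup [set const_kernel mu1 x [set: E] | x in [set: X]] <= 1)%E.
Proof. by apply: ge_ereal_sup => _ [x _ <-]. Qed.

HB.instance Definition _ := Kernel_isSubProbability.Build _ _ _ _ R
  (const_kernel mu1) const_kernel_le1.

End ConstKernel.

Section PullbackKernel.
Context d d' d2 (X : measurableType d) (X' : measurableType d') (E : measurableType d2).
Context (R : realType).
Variables (k : R.-pker X ~> E) (f : X' -> X).

Definition pullback_kernel (mf : measurable_fun setT f) : X' -> {measure set E -> \bar R} :=
  fun x => k (f x).

Hypothesis mf : measurable_fun setT f.

Let measurable_pullback_kernel U : measurable U ->
  measurable_fun [set: X'] (pullback_kernel mf ^~ U).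
Proof. by move=> mU; exact: (measurableT_comp (measurable_kernel k U mU) mf). Qed.

HB.instance Definition _ := isKernel.Build _ _ _ _ _ (pullback_kernel mf)
  measurable_pullback_kernel.

Let pullback_kernel_prob x : pullback_kernel mf x [set: E] = 1%E.
Proof. exact: prob_kernel. Qed.

HB.instance Definition _ := Kernel_isProbability.Build _ _ _ _ _
  (pullback_kernel mf) pullback_kernel_prob.

End PullbackKernel.

Definition image_measure (R : realType) d d' (E : measurableType d) (E' : measurableType d')
    (f : E -> E') (mf : measurable_fun setT f) (mu : {measure set E -> \bar R}) :
    {measure set E' -> \bar R} :=
  measure_function_pushforward__canonical__measure_function_Measure mu mf.

Section PushforwardKernel.
Context d d' d2 (X : measurableType d) (E : measurableType d') (E' : measurableType d2).
Context (R : realType).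
Variables (k : R.-pker X ~> E) (f : {mfun E >-> E'}).

Definition pushforward_kernel : X -> {measure set E' -> \bar R} :=
  fun x => image_measure (@measurable_funPT _ _ _ _ f) (k x).

Let measurable_pushforward_kernel U : measurable U ->
  measurable_fun [set: X] (pushforward_kernel ^~ U).
Proof.
move=> mU; apply: (measurable_kernel k (f @^-1` U)).
by rewrite -[X in measurable X]setTI; exact: measurable_funPT.
Qed.

HB.instance Definition _ := isKernel.Build _ _ _ _ _ (pushforward_kernel)
  measurable_pushforward_kernel.

Let pushforward_kernel_prob x : pushforward_kernel x [set: E'] = 1%E.
Proof. by rewrite /pushforward_kernel /= /pushforward preimage_setT prob_kernel. Qed.

HB.instance Definition _ := Kernel_isProbability.Build _ _ _ _ _
  (pushforward_kernel) pushforward_kernel_prob.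

End PushforwardKernel.

Section Disintegration.
Context (R : realType) d (Omega : measurableType d) (P : probability Omega R).
Context d' (E : measurableType d') d2 (F : measurableType d2).
Variables (T : {mfun Omega >-> F}) (W : {mfun Omega >-> E}) (kappa : R.-pker E ~> F).
Let mT : measurable_fun setT T. Proof. exact: measurable_funPT. Qed.
Let mW : measurable_fun setT W. Proof. exact: measurable_funPT. Qed.

Hypothesis hk : forall (A : set E) (B : set F), measurable A -> measurable B ->
  P (T @^-1` B `&` W @^-1` A) = (\int[P]_(w in W @^-1` A) kappa (W w) B)%E.

(** The defining identity of the kernel passes from indicators to nonnegative functions. *)
Lemma ge0_disintegration (g : F -> \bar R) A : (forall t, (0 <= g t)%E) ->
  measurable_fun setT g -> measurable A ->
  (\int[P]_(w in W @^-1` A) g (T w) =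
   \int[P]_(w in W @^-1` A) \int[kappa (W w)]_t g t)%E.
Proof.
move=> g0 mg mA.
have mWA : measurable (W @^-1` A) by rewrite -[X in measurable X]setTI; exact: mW.
pose mu : {measure set E -> \bar R} := image_measure mW (mrestr P mWA).
have mu1 : (mu setT <= 1)%E.
  by rewrite /mu /= /pushforward /mrestr preimage_setT setTI probability_le1.
have mI : measurable_fun setT (fun y => \int[kappa y]_t g t)%E.
  by apply: measurable_fun_integral_kernel => // U mU; exact: measurable_kernel.
have I0 y : (0 <= \int[kappa y]_t g t)%E by exact: integral_ge0.
have mu_int (h : E -> \bar R) : (forall y, (0 <= h y)%E) -> measurable_fun setT h ->
    (\int[mu]_y h y = \int[P]_(w in W @^-1` A) h (W w))%E.
  move=> h0 mh; transitivity (\int[mrestr P mWA]_w h (W w))%E.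
    exact: (ge0_integral_pushforward mW (mrestr P mWA) measurableT mh (fun y _ => h0 y)).
  by rewrite ge0_integral_mrestr //; exact: measurableT_comp mh mW.
(* The law of [T] on [W \in A] is the composition of the law of [W] with [kappa]. *)
pose k := pullback_kernel kappa (@measurable_snd _ _ unit E).
transitivity (\int[kcomp (const_kernel (X := unit) mu1) k tt]_t g t)%E; last first.
  by rewrite integral_kcomp //; exact: (mu_int _ I0 mI).
transitivity (\int[image_measure mT (mrestr P mWA)]_t g t)%E.
  transitivity (\int[mrestr P mWA]_w g (T w))%E.
    by rewrite ge0_integral_mrestr //; exact: measurableT_comp mg mT.
  apply/esym.
  exact: (ge0_integral_pushforward mT (mrestr P mWA) measurableT mg (fun y _ => g0 y)).
apply: eq_measure_integral => B mB _.
rewrite [RHS]mu_int //; last exact: measurable_kernel.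
by rewrite -hk.
Qed.

Variable g : F -> R.
Hypotheses (mg : measurable_fun setT g)
  (ig : P.-integrable setT (EFin \o (g \o T))).

Let mgE : measurable_fun setT (EFin \o g).
Proof. exact/measurable_realfun.measurable_EFinP. Qed.

Let mIk (h : F -> \bar R) : (forall t, (0 <= h t)%E) -> measurable_fun setT h ->
  measurable_fun setT (fun y => \int[kappa y]_t h t)%E.
Proof.
by move=> h0 mh; apply: measurable_fun_integral_kernel => // U mU; exact: measurable_kernel.
Qed.

Lemma measurable_kernel_mean : measurable_fun setT (fun y => \int[kappa y]_t g t).
Proof.
apply: measurableT_comp => //.
under eq_fun do rewrite integralE.
by apply: emeasurable_funB; apply: mIk => //; [exact: measurable_funepos|exact: measurable_funeneg].
Qed.

Lemma integrable_kernel_abs :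
  P.-integrable setT (fun w => \int[kappa (W w)]_t (`|g t|)%:E)%E.
Proof.
have ma : measurable_fun setT (fun t => (`|g t|)%:E).
  by apply/measurable_realfun.measurable_EFinP; exact: measurableT_comp mg.
apply/integrableP; split.
  exact: (measurableT_comp (mIk (fun=> _) ma) mW).
under eq_integral do rewrite gee0_abs ?integral_ge0 //.
have := @ge0_disintegration (fun t => (`|g t|)%:E) setT _ ma measurableT.
rewrite preimage_setT => <- //.
by have /integrableP [_] := ig.
Qed.

Lemma ae_integrable_kernel :
  {ae P, forall w, (kappa (W w)).-integrable setT (EFin \o g)}.
Proof.
have := integrable_ae measurableT integrable_kernel_abs.
apply: filterS => w /(_ Logic.I) fin; apply/integrableP; split=> //.
by rewrite -ge0_fin_numE ?integral_ge0.
Qed.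

Lemma integrable_kernel_mean :
  P.-integrable setT (EFin \o (fun w => \int[kappa (W w)]_t g t)).
Proof.
apply: le_integrable integrable_kernel_abs => //.
  by apply/measurable_realfun.measurable_EFinP; exact: measurableT_comp measurable_kernel_mean mW.
move=> w _ /=; rewrite gee0_abs ?integral_ge0 //.
apply: le_trans (le_abse_integral _ _ mgE) => //.
by rewrite /Rintegral /=; case: (\int[_]_(_ in _) _)%E => [r||] //=; rewrite normr0 leey.
Qed.

(** Positive and negative parts are treated separately. Their difference is identified with the
    kernel integral of [g] where [g] is integrable for the kernel, which is almost surely the
    case. *)
Lemma disintegration A : measurable A ->
  \int[P]_(w in W @^-1` A) g (T w) =
  \int[P]_(w in W @^-1` A) (\int[kappa (W w)]_t g t).
Proof.
move=> mA.
have mWA : measurable (W @^-1` A) by rewrite -[X in measurable X]setTI; exact: mW.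
congr fine.
pose gp := (EFin \o g)^\+%E; pose gn := (EFin \o g)^\-%E.
have mgp : measurable_fun setT gp by exact: measurable_funepos.
have mgn : measurable_fun setT gn by exact: measurable_funeneg.
have iA : P.-integrable (W @^-1` A) (EFin \o (g \o T)) by exact: integrableS ig.
have dis (h : F -> \bar R) : (forall t, (0 <= h t)%E) -> measurable_fun setT h ->
    P.-integrable (W @^-1` A) (h \o T) ->
    P.-integrable (W @^-1` A) (fun w => \int[kappa (W w)]_t h t)%E.
  move=> h0 mh /integrableP [_ fin]; apply/integrableP; split.
    by apply: measurable_funTS; exact: (measurableT_comp (mIk h0 mh) mW).
  under eq_integral do rewrite gee0_abs ?integral_ge0 //.
  rewrite -ge0_disintegration //.
  apply: le_lt_trans fin; rewrite le_eqVlt; apply/orP; left; apply/eqP.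
  by apply: eq_integral => w _; rewrite gee0_abs //=.
have pE : (EFin \o (g \o T))^\+%E = gp \o T by apply/funext => w; rewrite /gp /= !funeposE.
have nE : (EFin \o (g \o T))^\-%E = gn \o T by apply/funext => w; rewrite /gn /= !funenegE.
have ip : P.-integrable (W @^-1` A) (fun w => \int[kappa (W w)]_t gp t)%E.
  have := integrable_funepos mWA iA; rewrite pE => i; apply: (dis gp _ mgp i) => t.
  exact: funepos_ge0.
have in_ : P.-integrable (W @^-1` A) (fun w => \int[kappa (W w)]_t gn t)%E.
  have := integrable_funeneg mWA iA; rewrite nE => i; apply: (dis gn _ mgn i) => t.
  exact: funeneg_ge0.
transitivity (\int[P]_(w in W @^-1` A) (\int[kappa (W w)]_t gp t - \int[kappa (W w)]_t gn t))%E.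
  rewrite (integralB mWA ip in_) [LHS](integralE _ _ (EFin \o (g \o T))) pE nE.
  congr (_ - _)%E.
    by apply: ge0_disintegration => // t; exact: funepos_ge0.
  by apply: ge0_disintegration => // t; exact: funeneg_ge0.
apply: ae_eq_integral => //.
- by case/integrableP: (integrableB mWA ip in_).
- apply: measurable_funTS; apply/measurable_realfun.measurable_EFinP.
  exact: measurableT_comp measurable_kernel_mean mW.
have := ae_integrable_kernel; apply: filterS => w iw _ /=.
rewrite /Rintegral fineK; first by rewrite [RHS]integralE.
exact: integrable_fin_num.
Qed.

End Disintegration.

(** * Conditional laws with finite support *)

Lemma integral_seq_set (R : realType) (H : completeNormedModType R)
    (k : {measure set (borel H) -> \bar R}) (g : borel H -> R) (r : seq H) :
  measurable_fun setT g -> uniq r ->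
  measurable ([set` r] : set (borel H)) /\
  (\int[k]_(y in [set` r]) (g y)%:E = \sum_(y <- r) (g y)%:E * k [set y])%E.
Proof.
move=> mg; elim: r => [|y r IH].
  by move=> _; rewrite set_nil integral_set0 big_nil; split.
move=> /= /andP[yr ur]; have [mr Ir] := IH ur.
have my := borel_set1 y.
have -> : [set` y :: r] = [set y] `|` [set` r].
  apply/seteqP; split=> z /=; rewrite inE; first by move=> /orP[/eqP|]; [left|right].
  by move=> [->|->]; rewrite ?eqxx ?orbT.
split; first exact: measurableU.
rewrite integral_setU //; last 2 first.
- by apply: measurable_funTS; apply/measurable_EFinP.
- by apply/disj_setPS => z [/= ->]; rewrite (negbTE yr).
rewrite big_cons -Ir; congr (_ + _)%E.
rewrite -(@integral_cst _ _ _ k _ my); apply: eq_integral => z; rewrite inE => -> //.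
Qed.

Lemma integral_seq_support (R : realType) (H : completeNormedModType R)
    (k : {measure set (borel H) -> \bar R}) (r : seq H) (g : borel H -> R) :
  k setT = 1%E -> uniq r -> k (~` [set` r]) = 0%E -> measurable_fun setT g ->
  k.-integrable setT (EFin \o g) /\
  \int[k]_y g y = \sum_(y <- r) fine (k [set y]) * g y.
Proof.
move=> k1 ur kr mg.
have mr : measurable ([set` r] : set (borel H)) := (integral_seq_set k mg ur).1.
have kfin y : k [set y] \is a fin_num.
  rewrite ge0_fin_numE // (@le_lt_trans _ _ 1%E) ?ltry // -k1.
  by apply: le_measure; rewrite ?inE //; exact: borel_set1.
have mgE : measurable_fun setT (EFin \o g) by exact/measurable_EFinP.
have ig : k.-integrable setT (EFin \o g).
  apply/integrableP; split=> //.
  have mag : measurable_fun setT (fun y : borel H => `|g y|) by exact: measurableT_comp mg.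
  rewrite (@ge0_negligible_integral _ _ _ _ setT (~` [set` r] : set (borel H))) //; last 2 first.
  - exact: measurableC.
  - by apply/measurable_EFinP.
  rewrite setTD setCK (integral_seq_set k mag ur).2.
  rewrite (eq_bigr (fun y => (`|g y| * fine (k [set y]))%:E)); last first.
    by move=> y _; rewrite EFinM fineK.
  by rewrite sumEFin ltry.
split=> //; rewrite /Rintegral.
rewrite (@negligible_integral _ _ _ _ setT (~` [set` r] : set (borel H))) //; last exact: measurableC.
rewrite setTD setCK (integral_seq_set k mg ur).2.
rewrite (eq_bigr (fun y => (fine (k [set y]) * g y)%:E)); last first.
  by move=> y _; rewrite EFinM muleC fineK.
by rewrite sumEFin.
Qed.

Lemma measurable_range_ord (R : realType) (H : completeNormedModType R) q
    (t : 'I_q -> borel H) : measurable (range t).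
Proof.
have -> : range t = \bigcup_(i in [set: 'I_q]) [set t i].
  by apply/seteqP; split=> [_ [i _ <-]|_ [i _ ->]]; exists i.
by apply: fin_bigcup_measurable => // i _; exact: borel_set1.
Qed.

(** Turns a conditional law into a convex combination of at most [q] points of [X], to which (C)
    applies. *)
Lemma finite_support_integral (R : realType) (H : completeNormedModType R)
    (k : {measure set (borel H) -> \bar R}) (X : set H) q (t : 'I_q -> borel H) :
  k setT = 1%E -> measurable (X : set (borel H)) ->
  k (~` range t) = 0%E -> k (~` X) = 0%E ->
  exists n (x : 'I_n -> H) (a : 'I_n -> R), [/\ (n <= q)%N, forall i, X (x i),
    is_weights a & forall g : borel H -> R, measurable_fun setT g ->
      \int[k]_y g y = \sum_i a i * g (x i)].
Proof.
move=> k1 mX kt kX.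
(* Repetitions are removed so that no atom counts twice, and the values outside [X] carry no
   mass. *)
pose r : seq H := [seq y <- undup (codom t) | `[< X y >]].
have ur : uniq r by rewrite filter_uniq // undup_uniq.
have m1 : measurable_fun [set: borel H] (fun=> 1 : R) by exact: measurable_cst.
have mr : measurable ([set` r] : set (borel H)) := (integral_seq_set k m1 ur).1.
have mt := measurable_range_ord t.
have kr : k (~` [set` r]) = 0%E.
  apply/eqP; rewrite eq_le measure_ge0 andbT.
  apply: (@le_trans _ _ (k (~` range t `|` ~` X))).
    apply: le_measure; rewrite ?inE; [exact: measurableC| |].
      by apply: measurableU; exact: measurableC.
    move=> y /= yr; apply: contrapT => /not_orP [/contrapT [i _ ti] /contrapT Xy].
    by apply: yr; rewrite mem_filter asboolT // mem_undup -ti codom_f.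
  apply: (le_trans (measureU2 k (measurableC mt) (measurableC mX))).
  by rewrite [X in (X + _)%E]kt [X in (_ + X)%E]kX adde0.
pose x (i : 'I_(size r)) := tnth (in_tuple r) i.
pose a (i : 'I_(size r)) := fine (k [set x i]).
have formula (g : borel H -> R) : measurable_fun setT g -> \int[k]_y g y = \sum_i a i * g (x i).
  by move=> mg; rewrite (integral_seq_support k1 ur kr mg).2 big_tnth.
exists (size r), x, a; split=> //.
- rewrite size_filter (leq_trans (count_size _ _)) // (leq_trans (size_undup _)) //.
  by rewrite size_codom card_ord.
- move=> i; have := mem_tnth i (in_tuple r); rewrite mem_filter => /andP[/asboolP].
  by [].
- split=> [i|]; first exact: fine_ge0.
  have := formula _ m1; rewrite Rintegral_cst // mul1r k1 /= => ->.
  by apply: eq_bigr => i _; rewrite mulr1.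
Qed.

(** The difference has a constant sign on [D] and on its complement, so equal integrals there force
    it to vanish. Testing just these two sets suits conditional expectations, where both are events
    of the conditioning variable. *)
Lemma ae_eq_of_integrals (R : realType) d (Omega : measurableType d)
    (P : probability Omega R) (f h : Omega -> R) (D := [set w | h w <= f w]) :
  P.-integrable setT (EFin \o f) -> P.-integrable setT (EFin \o h) ->
  \int[P]_(w in D) f w = \int[P]_(w in D) h w ->
  \int[P]_(w in ~` D) f w = \int[P]_(w in ~` D) h w ->
  {ae P, forall w, f w = h w}.
Proof.
move=> if_ ih eD eC.
have mf : measurable_fun setT f by apply/measurable_EFinP; case/integrableP: if_.
have mh : measurable_fun setT h by apply/measurable_EFinP; case/integrableP: ih.
have mD : measurable D.
  by rewrite -[D]setTI; apply: measurable_fun_le.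
have mC : measurable (~` D) by exact: measurableC.
have aux (A : set Omega) (s : R) : measurable A ->
    (forall w, A w -> `|f w - h w| = s * (f w - h w)) ->
    \int[P]_(w in A) f w = \int[P]_(w in A) h w ->
    {ae P, forall w, A w -> f w = h w}.
  move=> mA sA eA.
  have ifA : P.-integrable A (EFin \o f) by exact: integrableS if_.
  have ihA : P.-integrable A (EFin \o h) by exact: integrableS ih.
  have ii := integrable_subr mA ifA ihA.
  have : (\int[P]_(w in A) `|(f w - h w)%:E| = 0)%E.
    transitivity (\int[P]_(w in A) (s * (f w - h w))%:E)%E.
      by apply: eq_integral => w /set_mem Aw; rewrite /= sA.
    have -> : (\int[P]_(w in A) (s * (f w - h w))%:E = s%:E * \int[P]_(w in A) (f w - h w)%:E)%E.
      exact: (integralZl mA ii).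
    have -> : (\int[P]_(w in A) (f w - h w)%:E)%E = (\int[P]_(w in A) (f w - h w))%:E.
      by rewrite /Rintegral fineK //; exact: integrable_fin_num.
    by rewrite RintegralB // eA subrr mule0.
  have mfh : measurable_fun A (fun w => (f w - h w)%:E) by case/integrableP: ii.
  move=> /(ae_eq_integral_abs P mA mfh).
  by apply: filterS => w h0 /h0 /= [] /eqP; rewrite subr_eq0 => /eqP.
have a1 := aux D 1 mD _ eD; have a2 := aux (~` D) (-1) mC _ eC.
apply: filterS2 (a1 _) (a2 _).
- move=> w w1 w2; have [|] := pselect (D w); [exact: w1|exact: w2].
- by move=> w Dw; rewrite mul1r ger0_norm // subr_ge0.
- move=> w /negP; rewrite -ltNge => lt; rewrite mulN1r ltr0_norm // subr_lt0 //.
Qed.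

(** Relative to [X], preimages of open sets are traces of open sets, since [v] maps the trace of
    [ball x e] into [ball (v x) e]; off [X] the function is constant. *)
Lemma measurable_lipschitz_patch (R : realType) (Z Y : completeNormedModType R)
    (X : set Z) (v : Z -> Y) : measurable (X : set (borel Z)) -> 1.-lipschitz_X v ->
  measurable_fun setT ((fun z => if `[< X z >] then v z else 0) : borel Z -> borel Y).
Proof.
move=> mX /lipschitz1P vl; apply: measurable_fun_borel => A oA.
set v' := fun z => _.
pose O := \bigcup_(i in [set i : Z * R | X i.1 /\ ball (v i.1) i.2 `<=` A]) (ball i.1 i.2).
have oO : open O by apply: bigcup_open => i _; exact: ball_open.
have -> : v' @^-1` A = (X `&` O) `|` (~` X `&` [set z | A 0]).
  apply/seteqP; split=> z; rewrite /v' /=.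
    case: asboolP => [Xz Av|Xz A0]; [left|by right].
    have /nbhs_ballP [e /= e0 eA] : nbhs (v z) A by exact: open_nbhs_nbhs.
    by split=> //; exists (z, e) => //=; exact: ballxx.
  move=> [[Xz [[x e] /= [Xx xA] xz]]|[Xz A0]]; last by rewrite asboolF.
  rewrite asboolT //; apply: xA; move: xz; rewrite -!ball_normE /= => xz.
  by rewrite (le_lt_trans (vl _ _ Xx Xz)).
apply: measurableU; first by apply: measurableI => //; exact: open_borel.
apply: measurableI; first exact: measurableC.
have [A0|A0] := pselect (A 0).
  have -> : [set _ : borel Z | A 0] = setT by apply/seteqP; split.
  exact: measurableT.
have -> : [set _ : borel Z | A 0] = set0 by apply/seteqP; split.
exact: measurable0.
Qed.

Lemma measurable_borel_scale (R : realType) (H : completeNormedModType R)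
    d (E : measurableType d) (f : E -> R) (y : H) : measurable_fun setT f ->
  measurable_fun setT ((fun e => f e *: y) : E -> borel H).
Proof.
move=> mf; apply: measurable_fun_borel => A oA.
have oO : open ((fun r : R => r *: y) @^-1` A).
  by move: A oA; apply/continuousP => r; apply: cvgZr_tmp; exact: cvg_id.
by rewrite -[X in measurable X]setTI; apply: (mf _ _ (open_measurable oO)).
Qed.

Lemma measurable_borel_sum (R : realType) (H : completeNormedModType R)
    (sH : separable H) d (E : measurableType d) I (s : seq I) (f : I -> E -> borel H) :
  (forall i, measurable_fun setT (f i)) ->
  measurable_fun setT ((fun e => \sum_(i <- s) (f i e : H)) : E -> borel H).
Proof.
move=> mf; elim: s => [|i s IH].
  by rewrite (_ : (fun _ => _) = cst (0 : borel H)) //; apply/funext => e; rewrite big_nil.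
rewrite (_ : (fun _ => _) = (fun e => (f i e : H) + \sum_(j <- s) (f j e : H))).
  exact: (measurable_borel_add sH (mf i) IH).
by apply/funext => e; rewrite big_cons.
Qed.

Lemma cond_expectation_measurable (R : realType) (H : completeNormedModType R)
    d (Omega : measurableType d) (P : probability Omega R) d' (E : measurableType d')
    (T : Omega -> borel H) (W : Omega -> E) (G : Omega -> borel H) :
  measurable_fun setT W -> is_cond_expectation P T W G -> measurable_fun setT G.
Proof.
by move=> mW [mG _] _ B mB; rewrite setTI; have [A mA <-] := mG _ mB; exact: mW.
Qed.

(** Both sides are measurable for [W] and have the same integrals over its events: one by definition
    of [G], the other by disintegration. *)
Lemma cond_expectation_kernel_mean (R : realType) (H : completeNormedModType R)
    (hH : is_hilbert H) (sH : separable H) d (Omega : measurableType d)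
    (P : probability Omega R) d' (E : measurableType d')
    (T : {mfun Omega >-> borel H}) (W : {mfun Omega >-> E}) (kappa : R.-pker E ~> borel H)
    (G : Omega -> borel H) (z : H) :
  is_cond_kernel P T W kappa -> is_cond_expectation P T W G ->
  {ae P, forall w, inner (G w : H) z = \int[kappa (W w)]_t inner (t : H) z}.
Proof.
move=> hk HG; have [mG hG] := HG.
have mWA A : measurable A -> measurable (W @^-1` A).
  by move=> mA; rewrite -[X in measurable X]setTI; exact: measurable_funPT.
have sub D : g_sigma_algebra_preimage W D -> exists2 A, measurable A & D = W @^-1` A.
  by move=> [A mA <-]; exists A => //; rewrite setTI.
have mGO : measurable_fun setT G.
  by apply: cond_expectation_measurable HG; exact: measurable_funPT.
have mT : measurable_fun setT T by exact: measurable_funPT.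
have g_T : g_sigma_algebra_preimage W setT by exists setT => //; rewrite setTI preimage_setT.
have [x xG xT] := hG _ g_T.
have [iG _] := bochner_integral_inner hH sH measurableT mGO xG.
have [iT _] := bochner_integral_inner hH sH measurableT mT xT.
have iGz := integrable_inner hH z measurableT mGO iG.
have iTz := integrable_inner hH z measurableT mT iT.
have mz : measurable_fun setT (fun t : borel H => inner (t : H) z).
  exact: (measurable_inner z (@measurable_id _ (borel H) setT)).
have mk := measurable_kernel_mean kappa mz.
have ik := integrable_kernel_mean hk mz iTz.
have eD D : g_sigma_algebra_preimage W D ->
    \int[P]_(w in D) inner (G w : H) z = \int[P]_(w in D) \int[kappa (W w)]_t inner (t : H) z.
  move=> gD; have [A mA DE] := sub _ gD; have [y yG yT] := hG _ gD.
  have mD : measurable D by rewrite DE; exact: mWA.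
  have [_ <-] := bochner_integral_inner hH sH mD mGO yG.
  have [_ ->] := bochner_integral_inner hH sH mD mT yT.
  by rewrite DE; exact: (disintegration hk mz iTz mA).
(* [OW] is [Omega] with the sigma-algebra of [W]; it serves to show that the comparison set is an
   event of [W]. *)
pose OW := g_sigma_algebra_preimageType W.
have mGW : measurable_fun setT (G : OW -> borel H).
  by move=> _ B mB; rewrite setTI; exact: mG.
have mWW : measurable_fun setT (W : OW -> E) by move=> _ B mB; exists B.
have gle : g_sigma_algebra_preimage W
    [set w | \int[kappa (W w)]_t inner (t : H) z <= inner (G w : H) z].
  have := @measurable_fun_le _ OW R setT (fun w => \int[kappa (W w)]_t inner (t : H) z)
    (fun w => inner (G w : H) z) measurableT
    (measurableT_comp mk mWW) (measurable_inner z mGW).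
  by rewrite setTI.
apply: ae_eq_of_integrals => //; apply: eD => //.
have [A mA <-] := gle; exists (~` A); first exact: measurableC.
by rewrite !setTI preimage_setC.
Qed.

(** * Transfer of a branching coupling along [v] *)

Lemma measure_full (R : realType) d (T : measurableType d) (mu : {measure set T -> \bar R})
    (A B : set T) : measurable A -> measurable B -> mu (~` A) = 0%E ->
  mu (B `&` A) = mu B.
Proof.
move=> mA mB A0; rewrite [RHS](measureDI mu mB mA).
rewrite [X in (X + _)%E](_ : _ = 0%E) ?add0e //.
apply/eqP; rewrite eq_le measure_ge0 andbT -A0; apply: le_measure; rewrite ?inE.
- exact: measurableD.
- exact: measurableC.
- by move=> x [].
Qed.

Section Transfer.
Context (R : realType) (Z Y : completeNormedModType R) (X : set Z) (v : Z -> Y).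
Hypotheses (mX : measurable (X : set (borel Z))) (vl : 1.-lipschitz_X v).

(** The value 0 off [X] makes [v] a total Borel map; the laws considered do not charge the
    complement of [X]. *)
Definition extension0 : borel Z -> borel Y := fun z => if `[< X z >] then v z else 0.

Lemma measurable_extension0 : measurable_fun setT extension0.
Proof. exact: measurable_lipschitz_patch. Qed.

Lemma extension0E z : X z -> extension0 z = v z.
Proof. by move=> Xz; rewrite /extension0 asboolT. Qed.

(** Linear growth carries the integrability of [T] over to its image. *)
Lemma extension0_growth : exists C, forall z, `|extension0 z : Y| <= C + `|z : Z|.
Proof.
have [[x Xx]|X0] := pselect (exists x, X x); last first.
  by exists 0 => z; rewrite /extension0 asboolF ?normr0 ?add0r // => Xz; apply: X0; exists z.
exists (`|v x| + `|x|) => z; rewrite /extension0.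
case: asboolP => [Xz|_]; last by rewrite normr0 !addr_ge0.
have := (lipschitz1P _ _).1 vl _ _ Xz Xx.
have := ler_normD (v z - v x) (v x); have := ler_normB z x; rewrite subrK; lra.
Qed.

Context d (Omega : measurableType d) (P : probability Omega R).

Lemma has_law_push (S : {mfun Omega >-> borel Z}) mu :
  has_law P S mu -> mu (~` X) = 0%E -> has_law P (extension0 \o S) (push_on X v mu).
Proof.
move=> lS muX B mB; rewrite /push_on.
have mS A : measurable A -> measurable (S @^-1` A).
  by move=> mA; rewrite -[X in measurable X]setTI; exact: measurable_funPT.
have mvB : measurable (extension0 @^-1` B).
  by rewrite -[X in measurable X]setTI; exact: measurable_extension0.
have -> : X `&` v @^-1` B = extension0 @^-1` B `&` X.
  by apply/seteqP; split=> z /= [] => [Xz|Bz Xz]; [rewrite extension0E|rewrite extension0E // in Bz].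
rewrite -lS; last exact: measurableI.
rewrite preimage_setI measure_full //; [exact: mS|exact: mS|].
exact: (eq_trans (lS _ (measurableC mX)) muX).
Qed.

Context d' (E : measurableType d') (q : nat).
Variables (S T : {mfun Omega >-> borel Z}) (U : {mfun Omega >-> E}).
Variable kappa : R.-pker (borel Z * E)%type ~> borel Z.

Lemma measurable_pair_fun d1 d2 (E1 : measurableType d1) (E2 : measurableType d2)
    (f : {mfun Omega >-> E1}) (g : {mfun Omega >-> E2}) :
  measurable_fun setT (fun w => (f w, g w)).
Proof. by apply: measurable_fun_pair; exact: measurable_funPT. Qed.

Let W := mfun_of (measurable_pair_fun S U).

Definition push_mfun (f : {mfun Omega >-> borel Z}) : {mfun Omega >-> borel Y} :=
  mfun_of (measurableT_comp measurable_extension0 (@measurable_funPT _ _ _ _ f)).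

(** In use the first coordinate is a function of the second, so it is ignored and [kappa] is pushed
    forward. *)
Definition push_kernel : R.-pker (borel Y * (borel Z * E))%type ~> borel Y :=
  pullback_kernel (pushforward_kernel kappa (mfun_of measurable_extension0))
    (@measurable_snd _ _ (borel Y) (borel Z * E)%type).

Lemma is_cond_kernel_push : is_cond_kernel P T W kappa ->
  is_cond_kernel P (push_mfun T) (fun w => (push_mfun S w, W w)) push_kernel.
Proof.
move=> hk A B mA mB.
(* [(v S, (S, U))] is the image of [(S, U)] under [j], so conditioning on it gives no further
   information. *)
pose j (su : borel Z * E) := (extension0 su.1, su).
have mj : measurable_fun setT j.
  apply: measurable_fun_pair => //.
  exact: measurableT_comp measurable_extension0 measurable_fst.
apply: (hk (j @^-1` A) (extension0 @^-1` B)).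
  by rewrite -[X in measurable X]setTI; exact: mj.
by rewrite -[X in measurable X]setTI; exact: measurable_extension0.
Qed.

(** The auxiliary variable becomes all of [(S, U)], as [v S] alone may forget [S]; the image of at
    most [q] points has at most [q] points. *)
Lemma Gamma_push (sZ : separable Z) mu nu : mu (~` X) = 0%E -> nu (~` X) = 0%E ->
  has_law P S mu -> has_law P T nu -> standard_borel R E ->
  is_cond_kernel P T W kappa ->
  {ae pushforward P W, forall su, exists t : 'I_q -> borel Z, kappa su (~` range t) = 0%E} ->
  Gamma q (push_on X v mu) (push_on X v nu) P (push_mfun S) (push_mfun T) W.
Proof.
move=> muX nuX lS lT sE hk [N [mN PN hN]]; split.
- exact: has_law_push.
- exact: has_law_push.
- apply: standard_borel_prod sE; apply: standard_borel_borel => //; exact: norm_hausdorff.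
exists push_kernel; first exact: is_cond_kernel_push.
exists (snd @^-1` N); split.
- by rewrite -[X in measurable X]setTI; exact: measurable_snd.
- exact: PN.
move=> yw /= H; apply: hN => /= -[t kt]; apply: H; exists (extension0 \o t).
rewrite /push_kernel /pullback_kernel /pushforward_kernel /= /pushforward.
apply/eqP; rewrite eq_le; apply/andP; split; last exact: measure_ge0.
have kle : (kappa yw.2 (~` range t) <= 0)%E by rewrite kt.
apply: le_trans kle; apply: le_measure; rewrite ?inE.
- rewrite -[X in measurable X]setTI; apply: measurable_extension0 => //.
  by apply: measurableC; exact: measurable_range_ord.
- by apply: measurableC; exact: measurable_range_ord.
- by move=> z /= H [i _ ti]; apply: H; exists i => //=; rewrite ti.
Qed.

End Transfer.

Lemma Rintegral_pushforward (R : realType) d1 d2 (E1 : measurableType d1)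
    (E2 : measurableType d2) (f : E1 -> E2) (mf : measurable_fun setT f)
    (mu : {measure set E1 -> \bar R}) (g : E2 -> R) :
  measurable_fun setT g -> \int[image_measure mf mu]_y g y = \int[mu]_x g (f x).
Proof.
move=> mg; congr fine.
have mgE : measurable_fun setT (EFin \o g) by exact/measurable_EFinP.
rewrite (integralE _ _ (EFin \o g)) [RHS](integralE _ _ (EFin \o (g \o f))).
have push (h : E2 -> \bar R) : (forall y, (0 <= h y)%E) -> measurable_fun setT h ->
    (\int[image_measure mf mu]_y h y = \int[mu]_x h (f x))%E.
  by move=> h0 mh; exact: (ge0_integral_pushforward mf mu measurableT mh (fun y _ => h0 y)).
congr (_ - _)%E.
  rewrite push; last exact: measurable_funepos.
    by apply: eq_integral => x _; rewrite !funeposE.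
  by move=> y; exact: funepos_ge0.
rewrite push; last exact: measurable_funeneg.
  by apply: eq_integral => x _; rewrite !funenegE.
by move=> y; exact: funeneg_ge0.
Qed.

Lemma integrable_bigsum (R : realType) d (Omega : measurableType d)
    (P : probability Omega R) (D : set Omega) I (s : seq I) (f : I -> Omega -> R) :
  measurable D -> (forall i, P.-integrable D (EFin \o f i)) ->
  P.-integrable D (EFin \o (fun w => \sum_(i <- s) f i w)).
Proof.
move=> mD fi; elim: s => [|i s IH].
  rewrite (_ : _ \o _ = cst 0%E); first exact: integrable0.
  by apply/funext => w /=; rewrite big_nil.
rewrite (_ : _ \o _ = EFin \o (fun w => f i w + \sum_(j <- s) f j w)).
  exact: integrable_sumr.
by apply/funext => w /=; rewrite big_cons.
Qed.

(** * Conditional expectations in finite dimension *)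

Section KernelMean.
Context (R : realType) (H : completeNormedModType R) (m : nat).
Hypotheses (hH : is_hilbert H) (sH : separable H) (dimH : dim_eq H m).
Variable o : nat -> H.
Hypothesis oo : is_orthonormal m o.

(** The barycenter of [kappa e], written in the orthonormal basis [o] so that only real integrals
    occur. *)
Definition kernel_mean d (E : measurableType d) (kappa : R.-pker E ~> borel H) :
    E -> borel H :=
  fun e => \sum_(j < m) (\int[kappa e]_t inner (t : H) (o j)) *: o j.

Lemma measurable_innerl z : measurable_fun setT (fun t : borel H => inner (t : H) z).
Proof. exact: (measurable_inner z (@measurable_id _ (borel H) setT)). Qed.

Lemma inner_orthonormal_sum (c : 'I_m -> R) (i : 'I_m) :
  inner (\sum_(j < m) c j *: o j) (o i) = c i.
Proof.
rewrite inner_suml // (bigD1 i) //= innerZl // oo // eqxx mulr1.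
rewrite big1 ?addr0 // => k ki; rewrite innerZl // oo //.
by rewrite (negbTE (_ : val k != val i)) ?mulr0.
Qed.

(** Provides the version of the conditional expectation with which the transferred triple enters the
    infimum. Equality of integrals is checked coordinatewise by disintegration. *)
Lemma is_cond_expectation_kernel_mean d (Omega : measurableType d)
    (P : probability Omega R) d' (E : measurableType d')
    (T : {mfun Omega >-> borel H}) (W : {mfun Omega >-> E}) (kappa : R.-pker E ~> borel H) :
  is_cond_kernel P T W kappa -> P.-integrable setT (EFin \o (fun w => `|T w : H|)) ->
  is_cond_expectation P T W (kernel_mean kappa \o W).
Proof.
move=> hk iT.
have mT : measurable_fun setT T by exact: measurable_funPT.
have mW : measurable_fun setT W by exact: measurable_funPT.
have mK : measurable_fun setT (kernel_mean kappa).
  apply: measurable_borel_sum => // j; apply: measurable_borel_scale.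
  exact: (measurable_kernel_mean kappa (measurable_innerl (o j))).
have mG : measurable_fun setT (kernel_mean kappa \o W) by exact: measurableT_comp mK mW.
have iTz z := integrable_inner hH z measurableT mT iT.
have iG : P.-integrable setT (EFin \o (fun w => `|kernel_mean kappa (W w) : H|)).
  have ij : P.-integrable setT
      (EFin \o (fun w => \sum_(j < m) `|\int[kappa (W w)]_t inner (t : H) (o j)| * `|o j|)).
    apply: integrable_bigsum => // j.
    apply: (@integrable_le _ _ _ P _ _
      (fun w => `|o j| * `|\int[kappa (W w)]_t inner (t : H) (o j)|)) => //.
    - apply: measurable_funM => //; apply: measurableT_comp => //.
      exact: (measurableT_comp (measurable_kernel_mean kappa (measurable_innerl (o j))) mW).
    - by move=> w; rewrite normrM !normr_id mulrC.
    - apply: integrable_mulr => //.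
      exact: (integrable_abse (integrable_kernel_mean hk (measurable_innerl (o j)) (iTz (o j)))).
  apply: (integrable_le (measurableT) (measurable_borel_norm mG) _ ij) => w.
  rewrite normr_id; apply: le_trans (ler_norm_sum _ _ _) _.
  by apply: ler_sum => j _; rewrite normrZ.
split.
  move=> B mB; exists (kernel_mean kappa @^-1` B); last by rewrite setTI.
  by rewrite -[X in measurable X]setTI; exact: mK.
move=> D [A mA]; rewrite setTI => DE.
have mD : measurable D by rewrite -DE -[X in measurable X]setTI; exact: mW.
have [x xG] := bochner_integral_exists hH sH mD mG iG.
have [y yT] := bochner_integral_exists hH sH mD mT iT.
suff xy : x = y by exists x => //; rewrite xy.
rewrite (orthonormal_expand hH dimH x oo) (orthonormal_expand hH dimH y oo).
apply: eq_bigr => j _; congr (_ *: _).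
have [_ ->] := bochner_integral_inner hH sH mD mG xG.
have [_ ->] := bochner_integral_inner hH sH mD mT yT.
rewrite -DE (disintegration hk (measurable_innerl (o j)) (iTz (o j)) mA).
by apply: eq_Rintegral => w _ /=; rewrite /kernel_mean inner_orthonormal_sum.
Qed.

End KernelMean.

(** * Transfer of the cost along a map satisfying (C) *)

Section BcostPush.
Context (R : realType) (Z Y : completeNormedModType R) (X : set Z) (v : Z -> Y) (m : nat).
Hypotheses (hZ : is_hilbert Z) (sZ : separable Z) (hY : is_hilbert Y) (sY : separable Y).
Hypotheses (m0 : (0 < m)%N) (dimY : dim_eq Y m).
Hypotheses (mX : measurable (X : set (borel Z))) (vl : 1.-lipschitz_X v).

Lemma Bcost_push q (p : R) mu nu : 1 <= p -> contracts_barycenters X v q ->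
  mu (~` X) = 0%E -> nu (~` X) = 0%E ->
  (Bcost q p (push_on X v nu) (push_on X v mu) <= Bcost q p nu mu)%E.
Proof.
move=> p1 cb muX nuX; apply: le_ereal_inf_tmp.
move=> _ [d] [ Omega] [P] [d'] [E] [S] [T] [U] [G] [[lS lT sE [kappa hk hs]] hG ->].
have [w0 ow] := orthonormal_basis hY dimY m0.
pose W := mfun_of (measurable_pair_fun S U).
have GP := Gamma_push mX vl sZ muX nuX lS lT sE hk hs.
pose S' := push_mfun mX vl S; pose T' := push_mfun mX vl T.
pose W' := mfun_of (measurable_pair_fun S' W).
pose kappa' := push_kernel mX vl kappa.
have hk' : is_cond_kernel P T' W' kappa' by exact: is_cond_kernel_push.
have mG : measurable_fun setT G.
  apply: cond_expectation_measurable hG; exact: measurable_pair_fun.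
have [x xG xT] : exists2 x : Z, bochner_integral P setT G x & bochner_integral P setT T x.
  by apply: hG.2; exists setT => //; rewrite setTI preimage_setT.
have mT : measurable_fun setT T by exact: measurable_funPT.
have mS : measurable_fun setT S by exact: measurable_funPT.
have [iT _] := bochner_integral_inner hZ sZ measurableT mT xT.
have iT' : P.-integrable setT (EFin \o (fun w => `|T' w : Y|)).
  have [C vC] := extension0_growth vl.
  apply: (@integrable_le _ _ _ P setT _ (fun w => C + `|T w : Z|)) => //.
  - by apply: measurable_borel_norm; exact: measurable_funPT.
  - by move=> w; rewrite normr_id; exact: vC.
  - apply: integrable_sumr => //; apply: (@bounded_integrable _ _ _ P _ _ `|C|) => //.
pose G' := kernel_mean m w0 kappa' \o W'.
have hG' : is_cond_expectation P T' W' G' by exact: is_cond_expectation_kernel_mean.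
(* The transferred triple bounds the cost in [Y]; it remains to compare the integrands almost
   surely. *)
apply: (@le_trans _ _ (\int[P]_w ((`|(S' w : Y) - (G' w : Y)| `^ p)%:E))%E).
  apply: ereal_inf_lbound; exists d, Omega, P, _, _, S', T', W, G'.
  by split.
have mG' : measurable_fun setT G'.
  by apply: cond_expectation_measurable hG'; exact: measurable_funPT.
apply: ae_ge0_le_integral => //.
- apply/measurable_EFinP; apply: (measurableT_comp (measurable_powR p)).
  by apply: measurable_dist => //; exact: measurable_funPT.
- apply/measurable_EFinP; apply: (measurableT_comp (measurable_powR p)).
  exact: measurable_dist.
have [u du] := separable_sequence sZ.
(* Testing along a dense sequence leaves a single null set for all test vectors. *)
have aG : {ae P, forall w, forall n,
    inner (G w : Z) (u n) = \int[kappa (W w)]_t inner (t : Z) (u n)}.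
  apply: ae_foralln => n.
  exact: (@cond_expectation_kernel_mean _ _ hZ sZ _ _ P _ _ T W kappa G (u n)).
have aF : {ae P, forall w, exists t : 'I_q -> borel Z, kappa (W w) (~` range t) = 0%E}.
  have [N [mN PN hN]] := hs; exists (W @^-1` N); split => //.
    by rewrite -[X in measurable X]setTI; exact: measurable_funPT.
  by move=> w; exact: hN.
have aS : {ae P, forall w, X (S w)}.
  exists (S @^-1` (~` X)); split => //.
    by rewrite -[X in measurable X]setTI; apply: mS => //; exact: measurableC.
  by rewrite lS //; exact: measurableC.
(* [T] lies in [X] almost surely, so almost every conditional law is concentrated on [X]. *)
have aK : {ae P, forall w, kappa (W w) (~` X) = 0%E}.
  have mK : measurable_fun setT (fun w => kappa (W w) (~` X)).
    apply: (measurableT_comp (measurable_kernel kappa (~` X) _)); last exact: measurable_funPT.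
    exact: measurableC.
  have : (\int[P]_w `|kappa (W w) (~` X)| = 0)%E.
    under eq_integral do rewrite gee0_abs //.
    have := hk setT (~` X) measurableT (measurableC mX).
    rewrite preimage_setT setIT => <-.
    by rewrite lT //; exact: measurableC.
  move=> /(ae_eq_integral_abs P measurableT mK); apply: filterS => w; exact.
apply: filterS2 (filterI aG aF) (filterI aS aK) => w [Gw [t kt]] [Sw kX] _.
rewrite lee_fin; apply: ge0_ler_powR; rewrite ?nnegrE ?normr_ge0 //; first exact: le_trans p1.
have k1 : kappa (W w) setT = 1%E by exact: prob_kernel.
have [n [y [a [nq Xy wa formula]]]] := finite_support_integral k1 mX kt kX.
have -> : G w = \sum_i a i *: y i :> Z.
  apply: (inner_seq_inj hZ du) => k; rewrite Gw formula ?inner_suml //.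
    by apply: eq_bigr => i _; rewrite innerZl.
  exact: measurable_innerl.
have -> : G' w = \sum_i a i *: v (y i) :> Y.
  rewrite /G' /= /kernel_mean.
  have c j : \int[kappa' (W' w)]_t inner (t : Y) (w0 j) = inner (\sum_i a i *: v (y i)) (w0 j).
    transitivity (\int[kappa (W w)]_t inner (extension0 X v t : Y) (w0 j)).
      by apply: (Rintegral_pushforward _ _ (measurable_innerl (w0 j))).
    rewrite formula; last first.
      exact: measurableT_comp (measurable_innerl (w0 j)) (measurable_extension0 mX vl).
    by rewrite inner_suml //; apply: eq_bigr => i _; rewrite innerZl // extension0E.
  rewrite [RHS](orthonormal_expand hY dimY _ ow).
  by apply: eq_bigr => j _; congr (_ *: _); exact: c.
(* The two conditional means are the same convex combination of the points [y i] and of their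
   images, so (C) compares the distances. *)
rewrite /S' /= extension0E //; apply: cb => //.
by apply: leq_trans (max_card _) _; rewrite card_ord.
Qed.

End BcostPush.

(** * The cost from a Dirac mass *)

(** The left-hand side is the tangent at [a] of the [p]-th power, a convex function; Jensen's
    inequality is derived from it below. *)
Lemma powR_tangent (R : realType) (p a r : R) : 1 <= p -> 0 < a -> 0 <= r ->
  a `^ p * (1 - p) + a `^ p * p / a * r <= r `^ p.
Proof.
move=> p1 a0 r0; have p0 : 0 < p by exact: lt_le_trans p1.
pose s := r / a; have s0 : 0 <= s by rewrite divr_ge0 // ltW.
(* Young's inequality for [s * 1]. *)
have sp : p * s <= s `^ p + p - 1.
  move: p1; rewrite le_eqVlt => /orP[/eqP <-|p1]; first by rewrite powRr1 // mul1r; lra.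
  have q0 : 0 < (1 - p^-1)^-1 by rewrite invr_gt0 subr_gt0 invf_lt1.
  have := @conjugate_powR R s 1 p _ s0 ler01 p0 q0 _; rewrite invrK addrC subrK powR1 mul1r mulr1.
  move=> /(_ erefl) /(ler_wpM2l (ltW p0)); rewrite !mulrDr mulrN mulfV ?gt_eqF //.
  by rewrite [p * (_ / p)]mulrC divfK ?gt_eqF // mulr1; lra.
have -> : r = s * a by rewrite /s divfK // gt_eqF.
rewrite (powRM _ s0 (ltW a0)) (_ : _ / a * _ = a `^ p * (p * s)); last by field; rewrite gt_eqF.
by rewrite -mulrDr [leRHS]mulrC ler_wpM2l ?powR_ge0 //; lra.
Qed.

Section Atomic.
Context (R : realType) (H : completeNormedModType R) (l : nat).
Variables (t : 'I_l -> R) (x : 'I_l -> borel H).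

Lemma atomic_notin B : (forall i, ~ B (x i)) -> atomic t x B = 0%E.
Proof.
move=> Bx; rewrite /atomic big1 // => i _; rewrite diracE memNset ?mule0 //; exact: Bx.
Qed.

(* The proof [wt] is an argument so that the instances below can be declared. *)
Definition atomic_probability (wt : is_weights t) : set (borel H) -> \bar R := atomic t x.

Hypothesis wt : is_weights t.

(** Extending the families from ['I_l] to [nat] by default values writes the atomic measure as a
    finite [msum], from which its measure structure is taken. *)
Let w (n : nat) : R := if insub n is Some i then t i else 0.
Let w0 n : 0 <= w n. Proof. by rewrite /w; case: insubP => // i _ _; exact: wt.1. Qed.
Let z (n : nat) : borel H := if insub n is Some i then x i else 0.
Let mu : {measure set (borel H) -> \bar R} :=
  msum (fun n => mscale (NngNum (w0 n)) (dirac (z n))) l.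

Let atomicE : atomic t x = mu.
Proof.
have wE (i : 'I_l) : w i = t i by rewrite /w valK.
have zE (i : 'I_l) : z i = x i by rewrite /z valK.
by apply/funext => B; apply: eq_bigr => i _; rewrite -wE -zE.
Qed.

Let atomic0 : atomic_probability wt set0 = 0%E.
Proof. by rewrite /atomic_probability atomicE measure0. Qed.
Let atomic_ge0 B : (0 <= atomic_probability wt B)%E.
Proof. by rewrite /atomic_probability atomicE measure_ge0. Qed.
Let atomic_sigma_additive : semi_sigma_additive (atomic_probability wt).
Proof. by rewrite /atomic_probability atomicE; exact: measure_semi_sigma_additive. Qed.

HB.instance Definition _ := isMeasure.Build _ _ _ (atomic_probability wt)
  atomic0 atomic_ge0 atomic_sigma_additive.

Lemma atomic_setT : atomic t x setT = 1%E.
Proof.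
rewrite /atomic (eq_bigr (fun i => (t i)%:E)) ?sumEFin ?wt.2 // => i _.
by rewrite diracT mule1.
Qed.

HB.instance Definition _ := Measure_isProbability.Build _ _ _ (atomic_probability wt)
  atomic_setT.

(** Stated for any [k] with these values on Borel sets, so as to cover laws of random variables. *)
Lemma integral_atomic (k : {measure set (borel H) -> \bar R}) (g : borel H -> R) :
  (forall B, measurable B -> k B = atomic t x B) -> measurable_fun setT g ->
  k.-integrable setT (EFin \o g) /\ \int[k]_y g y = \sum_i t i * g (x i).
Proof.
move=> kE mg; pose r : seq H := undup (codom x).
have ur : uniq r := undup_uniq _.
have mr : measurable ([set` r] : set (borel H)) := (integral_seq_set k mg ur).1.
have xr i : x i \in r by rewrite mem_undup codom_f.
have k1 : k setT = 1%E by rewrite kE // atomic_setT.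
have kr : k (~` [set` r]) = 0%E.
  by rewrite kE; [apply: atomic_notin => i; apply; exact: xr|exact: measurableC].
have [ig ->] := integral_seq_support k1 ur kr mg; split=> //.
(* The points [x i] may coincide: the sum over distinct values is regrouped by indices. *)
transitivity (\sum_(y <- r) \sum_i t i * (x i == y)%:R * g y).
  apply: eq_bigr => y _; rewrite -mulr_suml kE; last exact: borel_set1.
  rewrite /atomic (eq_bigr (fun i => (t i * (x i == y)%:R)%:E)) ?sumEFin // => i _.
  rewrite diracE EFinM; congr (_ * (nat_of_bool _)%:R%:E)%E.
  by apply/idP/eqP; rewrite inE.
rewrite exchange_big; apply: eq_bigr => i _; rewrite (bigD1_seq (x i)) //= eqxx mulr1.
by rewrite big1 ?addr0 // => y yx; rewrite eq_sym (negbTE yx) mulr0 mul0r.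
Qed.

End Atomic.

Section ConstProbabilityKernel.
Context d d' (X : measurableType d) (E : measurableType d') (R : realType).
Variable P : probability E R.

Definition const_probability_kernel : X -> {measure set E -> \bar R} := fun=> P.

Let measurable_const_probability_kernel U : measurable U ->
  measurable_fun [set: X] (const_probability_kernel ^~ U).
Proof. by move=> _; exact: measurable_cst. Qed.

HB.instance Definition _ := isKernel.Build _ _ _ _ _ const_probability_kernel
  measurable_const_probability_kernel.

Let const_probability_kernel1 x : const_probability_kernel x [set: E] = 1%E.
Proof. exact: probability_setT. Qed.

HB.instance Definition _ := Kernel_isProbability.Build _ _ _ _ _
  const_probability_kernel const_probability_kernel1.

End ConstProbabilityKernel.

Lemma probability_integral_cst (R : realType) d (T : measurableType d)
    (P : probability T R) (c : \bar R) : (\int[P]_w c = c)%E.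
Proof. by rewrite integral_cst // [X in (_ * X)%E]probability_setT mule1. Qed.

Lemma probability_Rintegral_cst (R : realType) d (T : measurableType d)
    (P : probability T R) (c : R) : \int[P]_w c = c.
Proof. by rewrite /Rintegral probability_integral_cst. Qed.

Section BcostDirac.
Context (R : realType) (H : completeNormedModType R).
Hypotheses (hH : is_hilbert H) (sH : separable H).
Variables (q l : nat) (p : R) (z : H) (t : 'I_l -> R) (x : 'I_l -> H).
Hypotheses (p1 : 1 <= p) (wt : is_weights t).

(** [S] equals [z] almost surely and [G] has the mean of [T], the barycenter of the [x i]; Jensen's
    inequality concludes. *)
Lemma dirac_Bcost_ge :
  ((`|z - \sum_i t i *: x i| `^ p)%:E <=
   Bcost q p (atomic t (x : 'I_l -> borel H))
     (atomic (fun _ : 'I_1 => 1%R) (fun=> z : borel H)))%E.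
Proof.
apply: le_ereal_inf_tmp.
move=> _ [d] [ Omega] [P] [d'] [E] [S] [T] [U] [G] [[lS lT _ _] hG ->].
have mS : measurable_fun setT S by exact: measurable_funPT.
have mT : measurable_fun setT T by exact: measurable_funPT.
have mG : measurable_fun setT G.
  apply: cond_expectation_measurable hG; exact: measurable_pair_fun.
have mz := borel_set1 z.
have mc : measurable_fun setT (cst z : Omega -> borel H) by exact: measurable_cst.
have mr : measurable_fun setT (fun w => `|z - (G w : H)|) by exact: (measurable_dist sH mc mG).
have mp : measurable_fun setT (fun w => (`|z - (G w : H)| `^ p)%:E).
  by apply/measurable_EFinP; exact: (measurableT_comp (measurable_powR p)).
have -> : (\int[P]_w (`|(S w : H) - G w| `^ p)%:E = \int[P]_w (`|z - (G w : H)| `^ p)%:E)%E.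
  apply: ae_eq_integral => //.
    apply/measurable_EFinP; apply: (measurableT_comp (measurable_powR p)).
    exact: measurable_dist.
  exists (S @^-1` (~` [set z])); split.
  - by rewrite -[X in measurable X]setTI; apply: mS => //; exact: measurableC.
  - by apply: (eq_trans (lS _ (measurableC mz))); apply: atomic_notin => i; apply.
  - by move=> w /= Sz Sw; apply: Sz => _; rewrite Sw.
set a := `|_| `^ p; set c := (\int[P]_w _)%E.
have [cfin|] := ltP c +oo%E; last by rewrite leye_eq => /eqP ->; exact: leey.
have [b0|b0] := eqVneq (`|z - \sum_i t i *: x i|) 0.
  by rewrite /a b0 powR0 ?gt_eqF ?(lt_le_trans ltr01 p1) //; apply: integral_ge0.
have {b0} b0 : 0 < `|z - \sum_i t i *: x i| by rewrite lt_def b0 normr_ge0.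
set b := `|_| in b0 a *.
have [xG xG' xT] : exists2 y : H, bochner_integral P setT G y & bochner_integral P setT T y.
  by apply: hG.2; exists setT => //; rewrite setTI preimage_setT.
have [iG eG] := bochner_integral_inner hH sH measurableT mG xG'.
have [_ eT] := bochner_integral_inner hH sH measurableT mT xT.
have xGE : xG = \sum_i t i *: x i.
  apply: (inner_inj hH) => u; rewrite eT -(Rintegral_pushforward mT P (measurable_innerl u)).
  have [_ ->] := integral_atomic wt (k := image_measure mT P) lT (measurable_innerl u).
  rewrite inner_suml //.
  by apply: eq_bigr => i _; rewrite innerZl.
have ir : P.-integrable setT (EFin \o (fun w => `|z - (G w : H)|)).
  apply: (@integrable_le _ _ _ P setT _ (fun w => `|z| + `|G w : H|)) => //.
  - by move=> w; rewrite normr_id; exact: ler_normB.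
  - apply: integrable_sumr => //; apply: (@bounded_integrable _ _ _ P _ _ `|z|) => // w.
    by rewrite normr_id.
have br : b <= \int[P]_w `|z - (G w : H)|.
  (* The mean of [z - G] is [e], of norm [b]; testing against [e] itself bounds [b * b] by [b] times
     the mean of [|z - G|]. *)
  pose e := z - \sum_i t i *: x i.
  have iz : P.-integrable setT (EFin \o (fun _ : Omega => inner z e)).
    by apply: (@bounded_integrable _ _ _ P _ _ `|inner z e|).
  have iGe := integrable_inner hH e measurableT mG iG.
  have bE : b * b = \int[P]_w (inner z e - inner (G w : H) e).
    rewrite RintegralB // -eG probability_Rintegral_cst xGE -innerBl //.
    by rewrite innerxx.
  have : (\int[P]_w (inner z e - inner (G w : H) e) <= \int[P]_w (b * `|z - (G w : H)|)).
    apply: le_Rintegral => //; first exact: integrable_subr.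
      exact: integrable_mulr.
    by move=> w _; rewrite -innerBl // mulrC; exact: inner_le_norm.
  by rewrite -bE RintegralZl // ler_pM2l.
have ip : P.-integrable setT (fun w => (`|z - (G w : H)| `^ p)%:E).
  apply/integrableP; split=> //; under eq_integral do rewrite gee0_abs ?lee_fin ?powR_ge0 //.
  exact: cfin.
(* The tangent at [b] lies below the power and, by [br], its mean is at least [a]. *)
pose L w := a * (1 - p) + a * p / b * `|z - (G w : H)|.
have i1 : P.-integrable setT (EFin \o (fun _ : Omega => a * (1 - p))).
  by apply: (@bounded_integrable _ _ _ P _ _ `|a * (1 - p)|).
have i2 : P.-integrable setT (EFin \o (fun w => a * p / b * `|z - (G w : H)|)).
  exact: integrable_mulr.
have iL : P.-integrable setT (EFin \o L) by exact: integrable_sumr.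
apply: (@le_trans _ _ (\int[P]_w (L w)%:E)%E); last first.
  by apply: le_integral => // w _; rewrite lee_fin; exact: powR_tangent.
have -> : (\int[P]_w (L w)%:E = (\int[P]_w L w)%:E)%E.
  by rewrite /Rintegral fineK //; exact: integrable_fin_num.
rewrite lee_fin RintegralD // (RintegralZl _ measurableT ir).
rewrite (probability_Rintegral_cst P (a * (1 - p))).
have a0 : 0 <= a by exact: powR_ge0.
have : a * p / b * b <= a * p / b * \int[P]_w `|z - (G w : H)|.
  by rewrite ler_wpM2l // !mulr_ge0 ?invr_ge0 ?(le_trans ler01 p1) // ltW.
by rewrite divfK ?gt_eqF //; lra.
Qed.

(** Competitor: [T] is the identity under the atomic law and [S], [U] are constant. Conditioning is
    trivial, so the kernel is the atomic law itself, carried by at most [l] points. *)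
Lemma dirac_Bcost_le :
  (Bcost l p (atomic t (x : 'I_l -> borel H))
     (atomic (fun _ : 'I_1 => 1%R) (fun=> z : borel H)) <=
   (`|z - \sum_i t i *: x i| `^ p)%:E)%E.
Proof.
pose P : probability (borel H) R := atomic_probability (x : 'I_l -> borel H) wt.
have PT : P setT = 1%E := probability_setT P.
have mc (c : H) : measurable_fun setT (cst c : borel H -> borel H) by exact: measurable_cst.
pose S := mfun_of (mc z); pose T := mfun_of (@measurable_id _ (borel H) setT).
pose y := \sum_i t i *: x i; pose W (w : borel H) := (S w, S w).
have W_cst A : W @^-1` A = setT \/ W @^-1` A = set0.
  by have [Az|Az] := pselect (A (z, z)); [left|right]; apply/seteqP; split.
have iT : P.-integrable setT (EFin \o (fun w => `|T w : H|)).
  apply: (integral_atomic wt (k := P) (fun _ _ => erefl) _).1.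
  exact/measurable_borel_norm/measurable_id.
have iG : P.-integrable setT (EFin \o (fun w : borel H => `|cst y w : H|)).
  apply: (@bounded_integrable _ _ _ P _ _ `|y|) => [//||w].
    exact: (measurable_borel_norm (mc y)).
  by rewrite /= normr_id.
apply: ereal_inf_lbound.
exists _, (borel H), P, _, (borel H), S, T, S, (cst y : borel H -> borel H).
split; last by apply: esym; exact: (probability_integral_cst P (`|z - y| `^ p)%:E).
  split=> //.
  - move=> B mB; rewrite /atomic big_ord1 mul1e diracE.
    have [Bz|Bz] := pselect (B z).
      by rewrite mem_set // -[RHS]PT; congr (P _); apply/seteqP; split.
    rewrite memNset // -[RHS](measure0 P); congr (P _).
    by apply/seteqP; split.
  - by apply: standard_borel_borel => //; exact: norm_hausdorff.
  exists (const_probability_kernel P).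
    move=> A B mA mB; rewrite -/W.
    have [->|->] := W_cst A; first by rewrite setIT probability_integral_cst.
    by rewrite setI0 measure0 integral_set0.
  exists set0; split; [exact: measurable0|exact: (measure0 P)|].
  move=> su /= nsu; case: nsu; exists x; rewrite /const_probability_kernel.
  by apply: atomic_notin => i; apply; exists i.
split.
  move=> B mB; have [yB|yB] := pselect (B y).
    by exists setT => //; rewrite setTI; apply/seteqP; split.
  by exists set0 => //; rewrite setTI; apply/seteqP; split.
move=> D [A mA]; rewrite setTI -/W => DE.
have mD : measurable D by rewrite -DE; have [->|->] := W_cst A.
have mT : measurable_fun setT T by exact: measurable_funPT.
have [a aG] := bochner_integral_exists hH sH mD (mc y) iG.
have [b bT] := bochner_integral_exists hH sH mD mT iT.
suff ab : a = b by exists a => //; rewrite ab.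
apply: (bochner_integral_eq hH sH mD (mc y) mT aG bT) => u.
rewrite -DE; have [->|->] := W_cst A; last by rewrite !Rintegral_set0.
transitivity (inner y u); first exact: (probability_Rintegral_cst P (inner y u)).
rewrite (integral_atomic wt (k := P) (fun _ _ => erefl) (measurable_innerl u)).2.
by rewrite inner_suml //; apply: eq_bigr => i _; rewrite innerZl.
Qed.

End BcostDirac.

(** * Equivalence of (E) with the cost inequality, and the inequality for general measures *)

Theorem proposition6p1 (R : realType) (Z Y : completeNormedModType R) (m : nat)
    (X : set Z) (v : Z -> Y)
    (hZ : is_hilbert Z) (sZ : separable Z)
    (hY : is_hilbert Y) (sY : separable Y)
    (hm : (1 <= m)%N) (dimY : dim_eq Y m)
    (mX : measurable (X : set (borel Z))) :
  (property_E X v <->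
     exists2 p : R, 1 <= p &
       forall (k l : nat) (a : 'I_k -> R) (b : 'I_l -> R)
              (x : 'I_k -> Z) (y : 'I_l -> Z),
         is_weights a -> is_weights b ->
         (forall i, X (x i)) -> (forall j, X (y j)) ->
         (Bcost m p (atomic b (v \o y : 'I_l -> borel Y))
                    (atomic a (v \o x : 'I_k -> borel Y))
          <= Bcost m p (atomic b (y : 'I_l -> borel Z))
                       (atomic a (x : 'I_k -> borel Z)))%E)
  /\
  (property_E X v ->
     forall (p : R) (mu nu : probability (borel Z) R) (q : nat),
       1 <= p -> in_Pp p X mu -> in_Pp p X nu -> (1 <= q <= m)%N ->
       (Bcost q p (push_on X v nu) (push_on X v mu) <= Bcost q p nu mu)%E).
Proof.
case: m hm dimY => // n _ dimY.
have ineq : property_E X v -> forall (p : R) mu nu q, 1 <= p -> mu (~` X) = 0%E ->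
    nu (~` X) = 0%E -> (q <= n.+1)%N ->
    (Bcost q p (push_on X v nu) (push_on X v mu) <= Bcost q p nu mu)%E.
  move=> EX p mu nu q p1 muX nuX qn.
  have cb := property_E_contracts hZ hY dimY EX.
  have vl := contracts_lipschitz (ltn0Sn n) cb.
  exact: (Bcost_push hZ sZ hY sY (ltn0Sn n) dimY mX vl p1 (contracts_barycentersW qn cb)).
split; last first.
  by move=> EX p mu nu q p1 [_ muX] [_ nuX] /andP[_ qn]; exact: ineq.
split=> [EX|[p p1 le]].
  exists 1 => // k l a b x y _ _ Xx Xy.
  rewrite -(push_on_atomic v a Xx) -(push_on_atomic v b Xy); apply: ineq => //.
    by apply: atomic_notin => i; apply.
  by apply: atomic_notin => i; apply.
apply: (contracts_property_E hZ hY dimY _ (ltn0Sn n)).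
apply: contracts_barycenters_reindex => x t z Xz Xx wt.
have w1 : is_weights (fun _ : 'I_1 => 1 : R) by split=> //; rewrite big_ord1.
(* The Dirac mass at [z] and the atomic measure on the [n.+1] points turn the cost inequality into
   (C) raised to the power [p]. *)
have := le 1%N n.+1 _ t (fun=> z) x w1 wt (fun=> Xz) Xx.
move=> /(le_trans (dirac_Bcost_ge hY sY _ _ _ p1 wt)) /le_trans.
move=> /(_ _ (dirac_Bcost_le hZ sZ p z x wt)); rewrite lee_fin.
rewrite !leNgt; apply: contra; apply: gt0_ltr_powR; rewrite ?nnegrE //.
exact: lt_le_trans p1.
Qed.
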